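(* Let $(M,\tau)$ be a tracial von Neumann algebra with finitely generated unital $*$-subalgebra $A\subset M$. For a finite dimensional unital $*$-subalgebra $B\subset A$, one has \[ \sigma(A,\tau)=\sigma(B\subset A,\tau)+\sigma(B,\tau). \]
   Context: A tracial von Neumann algebra $(M,\tau)$ is a finite von Neumann algebra $M$ with a faithful normal tracial state $\tau$. $M^\circ$ is the opposite algebra with trace $\tau^\circ$, and $M\bar\otimes M^\circ$ carries the trace $\tau\otimes\tau^\circ$. For a unital $*$-subalgebra $A\subset M$, $L^2(A\otimes A^\circ,\tau\otimes\tau^\circ)$ is the closure of $A\otimes A^\circ$ in $L^2(M\bar\otimes M^\circ,\tau\otimes\tau^\circ)$ and $(A\otimes A^\circ)''$ is the von Neumann algebra generated by $A\otimes A^\circ$. This Hilbert space is an $A$-$A$ bimodule via $x\cdot\xi\cdot y=(x\otimes y^\circ)\xi$, and has the commuting right action of $(A\otimes A^\circ)''$ by right multiplication. A derivation is a linear map $\delta\colon A\to L^2(A\otimes A^\circ,\tau\otimes\tau^\circ)$ with $\delta(xy)=x\cdot\delta(y)+\delta(x)\cdot y$. Finitely generated means generated as a unital $*$-algebra by a finite set; for a unital $*$-subalgebra $B\subset A$, $A$ is finitely generated over $B$ if $A=B\langle X\rangle$ (the unital $*$-algebra generated by $B\cup X$) for some finite $X=X^*\subset A$. $\mathrm{Der}_{1\otimes1}(B\subset A,\tau)$ is the space of derivations $\delta$ vanishing on $B$ such that $1\otimes1\in\mathrm{dom}(\delta^* )$, where $\delta$ is viewed as a densely defined operator $L^2(A,\tau)\to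 L^2(A\otimes A^\circ,\tau\otimes\tau^\circ)$. If $X=X^*$ is finite and $A=B\langle X\rangle$, then $\phi_X(\delta)=(\delta(x))_{x\in X}$ is an injective right $(A\otimes A^\circ)''$-linear map with closed range from the space of all derivations vanishing on $B$ into $L^2(A\otimes A^\circ,\tau\otimes\tau^\circ)^X$, giving the norm $\|\delta\|_X=(\sum_{x\in X}\|\delta(x)\|^2)^{1/2}$; the topology is independent of $X$, and closures are taken in it. The free Stein dimension of $A$ over $B$ is \[\sigma(B\subset A,\tau)=\dim\overline{\mathrm{Der}_{1\otimes1}(B\subset A,\tau)}_{(A\otimes A^\circ)''},\] the von Neumann dimension (with respect to $\tau\otimes\tau^\circ$) of the right Hilbert $(A\otimes A^\circ)''$-module $\phi_X\big(\overline{\mathrm{Der}_{1\otimes1}(B\subset A,\tau)}\big)\subset L^2(A\otimes A^\circ,\tau\otimes\tau^\circ)^X$; it does not depend on $X$. One writes $\sigma(A,\tau)=\sigma(\mathbb{C}\subset A,\tau)$, and likewise $\sigma(B,\tau)=\sigma(\mathbb{C}\subset B,\tau)$. *)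

(* Defs.v *)
From HB Require Import structures.
From mathcomp Require Import all_boot all_order all_algebra.
From mathcomp Require Import all_classical all_reals all_analysis.
From mathcomp.real_closed Require Import complex.
Set Implicit Arguments.
Unset Strict Implicit.
Unset Printing Implicit Defensive.
Import Order.TTheory GRing.Theory Num.Theory.
Import numFieldNormedType.Exports.
Local Open Scope classical_set_scope.
Local Open Scope ring_scope.

(* Inner products are linear in the first variable. *)
Definition is_inner (R : realType) (H : completeNormedModType R[i])
    (ip : H -> H -> R[i]) : Prop :=
  [/\ forall (a : R[i]) (x y z : H), ip (a *: x + y) z = a * ip x z + ip y z,
      forall x y : H, ip y x = Num.conj (ip x y) &
      forall x : H, ip x x = `|x| ^+ 2].

Record hilbert (R : realType) := Hilbert {
  hilbert_sort :> completeNormedModType R[i];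
  ip : hilbert_sort -> hilbert_sort -> R[i];
  ipP : is_inner ip
}.

Section Operators.
Context {R : realType} {H : hilbert R}.
Implicit Types (S T x y : H -> H) (A : set (H -> H)).

Definition bounded_op T : Prop := linear T /\ continuous T.

Definition is_adjoint S T : Prop :=
  forall u v : H, ip (S u) v = ip u (T v).

Definition op_le S T : Prop := forall v : H, ip (S v) v <= ip (T v) v.

Definition commutant A : set (H -> H) :=
  [set T | bounded_op T /\ forall S, A S -> T \o S = S \o T].

Record unital_star_subalgebra A : Prop := UnitalStarSubalgebra {
  ussa_bounded : forall x, A x -> bounded_op x;
  ussa_id : A id;
  ussa_add : forall x y, A x -> A y -> A (x + y);
  ussa_scale : forall (a : R[i]) x, A x -> A (a *: x);
  ussa_mul : forall x y, A x -> A y -> A (x \o y);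
  ussa_star : forall x, A x -> exists2 y, A y & is_adjoint x y
}.

Definition von_neumann_algebra A : Prop :=
  unital_star_subalgebra A /\ commutant (commutant A) = A.

(* The scalar multiples of the identity, written $\mathbb{C}$ in
   $\sigma(\mathbb{C} \subset A, \tau)$. *)
Definition scalars : set (H -> H) := [set T | exists a : R[i], T = a *: id].

Definition finite_dimensional A : Prop :=
  exists (n : nat) (b : 'I_n -> H -> H),
    A = [set T | exists c : 'I_n -> R[i], T = \sum_(i < n) c i *: b i].

(* The unital *-algebra $B\langle X\rangle$ generated by B and X. *)
Definition generated_by (B X : set (H -> H)) : set (H -> H) :=
  smallest unital_star_subalgebra (B `|` X).

(* The finite set X is enumerated without repetition by 'I_n, X = X^*, and
   $A = B\langle X\rangle$. *)
Definition generating_set (B A : set (H -> H)) (n : nat) (X : 'I_n -> H -> H)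
    : Prop :=
  [/\ injective X,
      forall i, exists j, is_adjoint (X i) (X j) &
      A = generated_by B (range X)].

(* Normality: tau preserves suprema of bounded upward directed families of
   positive elements. *)
Definition normal_functional A (tau : (H -> H) -> R[i]) : Prop :=
  forall (D : set (H -> H)) (T : H -> H),
    D !=set0 -> D `<=` A -> (forall S, D S -> op_le 0 S) ->
    (forall S1 S2, D S1 -> D S2 ->
       exists S3, [/\ D S3, op_le S1 S3 & op_le S2 S3]) ->
    A T -> (forall S, D S -> op_le S T) ->
    (forall U, A U -> (forall S, D S -> op_le S U) -> op_le T U) ->
    forall c : R[i], (forall S, D S -> tau S <= c) -> tau T <= c.

(* Only the values of tau on A are meaningful. *)
Record faithful_normal_tracial_state A (tau : (H -> H) -> R[i]) : Prop :=
  FaithfulNormalTracialState {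
  fnts_linear : forall (a : R[i]) x y, A x -> A y ->
    tau (a *: x + y) = a * tau x + tau y;
  fnts_unit : tau id = 1;
  fnts_pos : forall x y, A x -> A y -> is_adjoint x y -> 0 <= tau (y \o x);
  fnts_faithful : forall x y, A x -> A y -> is_adjoint x y ->
    tau (y \o x) = 0 -> x = 0;
  fnts_tracial : forall x y, A x -> A y -> tau (x \o y) = tau (y \o x);
  fnts_normal : normal_functional A tau
}.

End Operators.

Record tracialVN (R : realType) := TracialVN {
  vN_space :> hilbert R;
  vN_alg : set (vN_space -> vN_space);
  vN_tr : (vN_space -> vN_space) -> R[i];
  vN_algP : von_neumann_algebra vN_alg;
  vN_trP : faithful_normal_tracial_state vN_alg vN_tr
}.
Arguments vN_alg {R} _ _.
Arguments vN_tr {R} _ _.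

(* The map op is $x \mapsto x^\circ$ and the trace of the target is
   $\tau^\circ$. *)
Record is_opposite (R : realType) (M N : tracialVN R)
    (op : (M -> M) -> (N -> N)) : Prop := IsOpposite {
  op_bij : set_bij (vN_alg M) (vN_alg N) op;
  op_linear : forall (a : R[i]) (x y : M -> M), vN_alg M x -> vN_alg M y ->
    op (a *: x + y) = a *: op x + op y;
  op_mul : forall x y : M -> M, vN_alg M x -> vN_alg M y ->
    op (x \o y) = op y \o op x;
  op_star : forall x y : M -> M, vN_alg M x -> vN_alg M y ->
    is_adjoint x y -> is_adjoint (op x) (op y);
  op_trace : forall x : M -> M, vN_alg M x -> vN_tr N (op x) = vN_tr M x
}.

Record opposite (R : realType) (M : tracialVN R) := Opposite {
  opp_vN :> tracialVN R;
  opp : (M -> M) -> (opp_vN -> opp_vN);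
  oppP : is_opposite opp
}.
Arguments opp {R M} _ _ _.

(* A Hilbert space tensor product of H and K: tens is the universal bilinear
   map on vectors and otens S T is the bounded operator $S \otimes T$, which is
   determined by its values on elementary tensors. *)
Record is_tensor (R : realType) (H K L : hilbert R) (tens : H -> K -> L)
    (otens : (H -> H) -> (K -> K) -> (L -> L)) : Prop := IsTensor {
  tens_linearl : forall (a : R[i]) (u u' : H) (v : K),
    tens (a *: u + u') v = a *: tens u v + tens u' v;
  tens_linearr : forall (a : R[i]) (u : H) (v v' : K),
    tens u (a *: v + v') = a *: tens u v + tens u v';
  tens_ip : forall (u u' : H) (v v' : K),
    ip (tens u v) (tens u' v') = ip u u' * ip v v';
  tens_dense : closure [set w | exists (n : nat) (u : 'I_n -> H)
    (v : 'I_n -> K), w = \sum_(i < n) tens (u i) (v i)] = setT;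
  otens_bounded : forall S T, bounded_op S -> bounded_op T ->
    bounded_op (otens S T);
  otens_tens : forall S T, bounded_op S -> bounded_op T ->
    forall (u : H) (v : K), otens S T (tens u v) = tens (S u) (T v)
}.

Record hilbert_tensor (R : realType) (H K : hilbert R) := HilbertTensor {
  tensor_space :> hilbert R;
  tens : H -> K -> tensor_space;
  otens : (H -> H) -> (K -> K) -> (tensor_space -> tensor_space);
  tensorP : is_tensor tens otens
}.
Arguments tens {R H K} _ _ _.
Arguments otens {R H K} _ _ _ _.

Definition vN_tensor_alg (R : realType) (M N : tracialVN R)
    (L : hilbert_tensor M N) : set (L -> L) :=
  commutant (commutant [set T | exists x y,
    [/\ vN_alg M x, vN_alg N y & T = otens L x y]]).

Arguments vN_tensor_alg {R M N} _ _.

(* $M \bar\otimes N$ with the trace $\tau_M \otimes \tau_N$. *)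
Record vN_tensor (R : realType) (M N : tracialVN R) := VNTensor {
  vNt_space : hilbert_tensor M N;
  vNt_tr : (vNt_space -> vNt_space) -> R[i];
  vNt_algP : von_neumann_algebra (vN_tensor_alg vNt_space);
  vNt_trP : faithful_normal_tracial_state (vN_tensor_alg vNt_space) vNt_tr;
  vNt_trE : forall x y, vN_alg M x -> vN_alg N y ->
    vNt_tr (otens vNt_space x y) = vN_tr M x * vN_tr N y
}.
Arguments vNt_tr {R M N} _ _.

Definition vN_tensor_tracialVN (R : realType) (M N : tracialVN R)
    (E : vN_tensor M N) : tracialVN R := TracialVN (vNt_algP E) (vNt_trP E).
Coercion vN_tensor_tracialVN : vN_tensor >-> tracialVN.

(* A GNS triple of the trace: L is $L^2(M,\tau)$, rep is left multiplication,
   and the class of $x \in M$ in L is rep x Om. *)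
Record is_gns (R : realType) (M : tracialVN R) (L : hilbert R)
    (rep : (M -> M) -> (L -> L)) (Om : L) : Prop := IsGns {
  rep_bounded : forall x, vN_alg M x -> bounded_op (rep x);
  rep_linear : forall (a : R[i]) (x y : M -> M), vN_alg M x -> vN_alg M y ->
    rep (a *: x + y) = a *: rep x + rep y;
  rep_mul : forall x y : M -> M, vN_alg M x -> vN_alg M y ->
    rep (x \o y) = rep x \o rep y;
  rep_id : rep id = id;
  rep_star : forall x y : M -> M, vN_alg M x -> vN_alg M y ->
    is_adjoint x y -> is_adjoint (rep x) (rep y);
  rep_cyclic : closure [set rep x Om | x in vN_alg M] = setT;
  rep_trace : forall x : M -> M, vN_alg M x -> ip (rep x Om) Om = vN_tr M x
}.

Record gns (R : realType) (M : tracialVN R) := Gns {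
  L2 :> hilbert R;
  lmul : (M -> M) -> (L2 -> L2);
  gns_vec : L2;
  gnsP : is_gns lmul gns_vec
}.
Arguments lmul {R M} _ _ _.
Arguments gns_vec {R M} _.

Definition hat (R : realType) (M : tracialVN R) (L : gns M) (x : M -> M) : L :=
  lmul L x (gns_vec L).

(* $L^2(A,\tau)$ as a subspace of $L^2(M,\tau)$. *)
Definition L2_sub (R : realType) (M : tracialVN R) (L : gns M)
    (A : set (M -> M)) : set L := closure [set hat L x | x in A].

Arguments L2_sub {R M} _ _.

Section Dimension.
Context {R : realType} {L : hilbert R} {n : nat}.
Implicit Types (u v w : 'I_n -> L) (V : set ('I_n -> L)).

Definition ipn u v : R[i] := \sum_(i < n) ip (u i) (v i).

Definition normn u : R[i] := sqrtC (ipn u u).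

(* Orthogonal projection onto the closed subspace V. *)
Definition proj V u : 'I_n -> L :=
  xget 0 [set w | V w /\ forall v, V v -> ipn (u - w) v = 0].

(* Let L be the L2-space of a tracial von Neumann algebra Q with trace vector
   one. An operator T on $L^2(Q)^n$ commuting with the right action of Q is left
   multiplication by a matrix t over Q, and $T e_i$ has i-th entry the class of
   $t_{ii}$; so the sum below is $(\mathrm{Tr} \otimes \tau)(t)$. *)
Definition Tr_tau (one : L) (T : ('I_n -> L) -> ('I_n -> L)) : R[i] :=
  \sum_(i < n) ip (T (fun j => if j == i then one else 0) i) one.

(* The dimension over Q of a closed right Q-submodule V of $L^2(Q)^n$. *)
Definition vN_dim (one : L) V : R := complex.Re (Tr_tau one (proj V)).

End Dimension.

Section FreeStein.
Context {R : realType} {M : tracialVN R} {Mo : opposite M}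
  {E : vN_tensor M Mo} (LM : gns M) (LE : gns E).
Implicit Types (A B : set (M -> M)) (x y : M -> M) (xi eta : LE)
  (d : (M -> M) -> LE).

Definition tensor_opp x y : E -> E := otens (vNt_space E) x (opp Mo y).

Definition bimod x xi y : LE := lmul LE (tensor_opp x y) xi.

Definition one_tensor_one : LE := hat LE (tensor_opp id id).

(* The algebraic tensor product of A and its opposite. *)
Definition alg_tensor_opp A : set (E -> E) :=
  [set T | exists (n : nat) (x y : 'I_n -> M -> M),
    [/\ forall i, A (x i), forall i, A (y i) &
        T = \sum_(i < n) tensor_opp (x i) (y i)]].

(* Only the values of d on A are meaningful. *)
Record derivation A d : Prop := Derivation {
  der_val : forall x, A x -> L2_sub LE (alg_tensor_opp A) (d x);
  der_linear : forall (a : R[i]) x y, A x -> A y ->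
    d (a *: x + y) = a *: d x + d y;
  der_leibniz : forall x y, A x -> A y ->
    d (x \o y) = bimod x (d y) id + bimod id (d x) y
}.

Definition Der B A : set ((M -> M) -> LE) :=
  [set d | derivation A d /\ forall b, B b -> d b = 0].

(* eta is in the domain of the adjoint of d, viewed as the densely defined
   operator $L^2(A,\tau) \to L^2(A \otimes A^\circ)$ with domain (the image of)
   A. *)
Definition in_dom_adjoint A d eta : Prop :=
  exists2 zeta : LM, L2_sub LM A zeta &
    forall x, A x -> ip (d x) eta = ip (hat LM x) zeta.

Definition Der11 B A : set ((M -> M) -> LE) :=
  [set d | Der B A d /\ in_dom_adjoint A d one_tensor_one].

Definition phi (n : nat) (X : 'I_n -> M -> M) d : 'I_n -> LE :=
  fun i => d (X i).

(* The closure of Der11 in the space Der of all derivations vanishing on B, for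
   the norm of X. *)
Definition closed_Der11 B A (n : nat) (X : 'I_n -> M -> M) :
    set ((M -> M) -> LE) :=
  [set d | Der B A d /\ forall eps : R[i], 0 < eps ->
    exists2 d', Der11 B A d' & normn (phi X (d - d')) < eps].

(* The free Stein dimension of A over B, computed with the generating set X of
   A over B. *)
Definition free_stein_dim B A (n : nat) (X : 'I_n -> M -> M) : R :=
  vN_dim one_tensor_one [set phi X d | d in closed_Der11 B A X].

End FreeStein.

(* Main.v *)
(* Every derivation [d] of [A] restricts to an inner derivation of [B]: with
   [\sum_k p_k (x) q_k] a separability idempotent of [B], one has
   [d b = b xi - xi b] on [B] for [xi = \sum_k p_k d(q_k)].  Inner derivations
   of [A] implemented by any vector [xi] of L^2 have [1 (x) 1] in the domain of
   the adjoint, so [d |-> (d - [., xi], d|_B)] identifies the closure of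
   [Der_{1(x)1}(C < A)] with the direct sum of that of [Der_{1(x)1}(B < A)] and
   the space of derivations from [B] to [L^2(A (x) A^o)].  In the coordinates of
   the generating sets all the maps are bounded and right-linear.  For such maps
   [Tr(S T) = Tr(T S)] follows from the modular conjugation [J], since
   [Tr(S T) = \sum_ij <(S e_j)_i, J (T e_i)_j>] is symmetric in [S] and [T];
   hence dimensions add.  Finally, projecting the vectors [e_i] onto the
   derivations of [B] with values in [L^2(A (x) A^o)] or in [L^2(B (x) B^o)]
   gives the same result, so the second summand is the dimension for [B]. *)

Require Import Defs.
From HB Require Import structures.
From mathcomp Require Import all_boot all_order all_algebra.
From mathcomp Require Import all_classical all_reals all_analysis.
From mathcomp.real_closed Require Import complex.
From mathcomp Require Import ring lra.
Set Implicit Arguments.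
Unset Strict Implicit.
Unset Printing Implicit Defensive.
Import Order.TTheory GRing.Theory Num.Theory.
Import numFieldNormedType.Exports.
Local Open Scope classical_set_scope.
Local Open Scope ring_scope.

(** * Inner products and Riesz representation *)

(** The splitting of a derivation into an inner one and one vanishing on B is not orthogonal, while
    [vN_dim] is defined by orthogonal projections. The bridge is Tr(S T) = Tr(T S) for maps between
    different powers of L^2: the trace of the idempotent that cuts out a summand equals the trace of
    the orthogonal projection onto a model of that summand. To apply it, the operations on
    derivations must become operators on generator values, so each value d x is exhibited as a fixed
    bounded right-linear function of the values of d on the generators. Projections act on powers of
    the whole of L^2(M (x) M^o). All maps are therefore defined there and required to preserve L^2(A
    (x) A^o); right-linearity is tested on elementary tensors over A, which is enough because the
    trace pairing is checked on their span and extended by density. One Riesz lemma for a functional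
    given on a dense domain produces the projections, the conjugation J and the vectors that witness
    membership in the domain of an adjoint. *)

Section InnerProductSpaces.
Variables (R : realType) (V : lmodType R[i]) (f : V -> V -> R[i]).

Record inner_form : Prop := InnerForm {
  form_lin : forall (a : R[i]) (x y z : V), f (a *: x + y) z = a * f x z + f y z;
  form_conj : forall x y : V, f y x = (f x y)^*;
  form_ge0 : forall x : V, 0 <= f x x;
  form_def : forall x : V, f x x = 0 -> x = 0
}.

Definition fnorm (v : V) : R[i] := sqrtC (f v v).

Definition cauchy_complete : Prop := forall u : nat -> V,
  (forall e : R[i], 0 < e ->
     exists N, forall p q, (N <= p)%N -> (N <= q)%N -> fnorm (u p - u q) < e) ->
  exists l, forall e : R[i], 0 < e -> exists N, forall p, (N <= p)%N ->
    fnorm (u p - l) < e.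

Hypothesis fP : inner_form.

Lemma formDl x y z : f (x + y) z = f x z + f y z.
Proof. by have := form_lin fP 1 x y z; rewrite scale1r mul1r. Qed.

Lemma form0l z : f 0 z = 0.
Proof. by apply: (addrI (f 0 z)); rewrite -formDl !addr0. Qed.

Lemma formZl a x z : f (a *: x) z = a * f x z.
Proof. by have := form_lin fP a x 0 z; rewrite !addr0 form0l addr0. Qed.

Lemma formNl x z : f (- x) z = - f x z.
Proof. by rewrite -scaleN1r formZl mulN1r. Qed.

Lemma formBl x y z : f (x - y) z = f x z - f y z.
Proof. by rewrite formDl formNl. Qed.

Lemma formDr x y z : f x (y + z) = f x y + f x z.
Proof. by rewrite (form_conj fP) formDl rmorphD /= -!(form_conj fP). Qed.

Lemma form0r z : f z 0 = 0.
Proof. by rewrite (form_conj fP) form0l rmorph0. Qed.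

Lemma formZr a x z : f x (a *: z) = a^* * f x z.
Proof. by rewrite (form_conj fP) formZl rmorphM /= -!(form_conj fP). Qed.

Lemma formNr x z : f x (- z) = - f x z.
Proof. by rewrite (form_conj fP) formNl rmorphN /= -!(form_conj fP). Qed.

Lemma formBr x y z : f x (y - z) = f x y - f x z.
Proof. by rewrite formDr formNr. Qed.

Lemma fnorm_ge0 x : 0 <= fnorm x.
Proof. by rewrite sqrtC_ge0 (form_ge0 fP). Qed.

Lemma fnorm_sqr x : fnorm x ^+ 2 = f x x.
Proof. exact: sqrtCK. Qed.

Lemma fnorm0 : fnorm 0 = 0.
Proof. by rewrite /fnorm form0l sqrtC0. Qed.

Lemma fnormZ a x : fnorm (a *: x) = `|a| * fnorm x.
Proof.
apply: (@pexpIrn _ 2) => //; rewrite ?nnegrE ?mulr_ge0 ?fnorm_ge0 //.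
by rewrite exprMn !fnorm_sqr formZl formZr normCK mulrA.
Qed.

Lemma fnormN x : fnorm (- x) = fnorm x.
Proof. by rewrite -scaleN1r fnormZ normrN1 mul1r. Qed.

Lemma fnormB x y : fnorm (x - y) = fnorm (y - x).
Proof. by rewrite -fnormN opprB. Qed.

Lemma cauchy_schwarz x y : `|f x y| <= fnorm x * fnorm y.
Proof.
rewrite -(@ler_pXn2r _ 2) ?nnegrE ?mulr_ge0 ?fnorm_ge0 // exprMn !fnorm_sqr.
have [y0|y0] := eqVneq (f y y) 0.
  by rewrite y0 mulr0 (form_def fP y0) form0r normr0 expr0n.
have yp : 0 < f y y by rewrite lt_def y0 (form_ge0 fP).
have /[!formBl] := form_ge0 fP (x - (f x y / f y y) *: y).
rewrite !formBr !formZl !formZr.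
have -> : (f x y / f y y)^* = (f x y)^* / f y y.
  by rewrite rmorphM fmorphV /= -(form_conj fP y y).
rewrite (form_conj fP x y).
have -> : f x x - (f x y)^* / f y y * f x y -
  (f x y / f y y * (f x y)^* - f x y / f y y * ((f x y)^* / f y y * f y y)) =
  f x x - `|f x y| ^+ 2 / f y y by rewrite normCK; field.
by rewrite subr_ge0 ler_pdivrMr.
Qed.

Lemma fnormD x y : fnorm (x + y) <= fnorm x + fnorm y.
Proof.
rewrite -(@ler_pXn2r _ 2) ?nnegrE ?addr_ge0 ?fnorm_ge0 //.
rewrite sqrrD !fnorm_sqr formDl !formDr.
have h : f x y + f y x <= (fnorm x * fnorm y) *+ 2.
  apply: le_trans (_ : `|f x y| + `|f y x| <= _).
    apply: le_trans (ler_normD _ _).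
    apply: real_ler_norm; rewrite (form_conj fP x y).
    by rewrite CrealE rmorphD /= conjCK addrC.
  by rewrite mulr2n lerD ?cauchy_schwarz // mulrC cauchy_schwarz.
have -> : f x x + f x y + (f y x + f y y) = f x y + f y x + (f x x + f y y).
  by ring.
by rewrite [leRHS]addrAC [leRHS]addrC lerD2r.
Qed.

Lemma form_dense0 (S : set V) v w :
  (forall e : R[i], 0 < e -> exists2 s, S s & fnorm (s - v) < e) ->
  (forall s, S s -> f s w = 0) -> f v w = 0.
Proof.
move=> Sv Sw; apply/eqP; rewrite -normr_eq0; apply/eqP/le_anti.
rewrite normr_ge0 andbT; apply/ler_addgt0Pl => e e0.
rewrite addr0.
have w1 : 0 < fnorm w + 1 by rewrite ltr_wpDl ?fnorm_ge0.
have [s Ss] := Sv (e / (fnorm w + 1)) (divr_gt0 e0 w1).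
rewrite ltr_pdivlMr // => /ltW h; apply: le_trans h.
rewrite -[f v w]subr0 -(Sw _ Ss) -formBl.
apply: le_trans (cauchy_schwarz _ _) _.
by rewrite fnormB ler_wpM2l ?fnorm_ge0 // lerDl.
Qed.

Hypothesis fC : cauchy_complete.

Let re := @complex.Re R.
Let n2 (v : V) : R := re (f v v).

Let reD : {morph re : x y / x + y}.
Proof. by case=> [? ?] [? ?]. Qed.

Let reN : {morph re : x / - x}.
Proof. by case. Qed.

Let n2E v : (n2 v)%:C%C = f v v.
Proof. by rewrite /n2 RRe_real // ger0_real // (form_ge0 fP). Qed.

Let n2_ge0 v : 0 <= n2 v.
Proof. by rewrite -lecR n2E (form_ge0 fP). Qed.

Let fnorm_lt v (e : R) : 0 < e -> n2 v < e ^+ 2 -> fnorm v < e%:C%C.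
Proof.
move=> e0 h; rewrite -(@ltr_pXn2r _ 2) ?nnegrE ?fnorm_ge0 ?lecR ?ltW //.
by rewrite fnorm_sqr -n2E -rmorphXn ltcR.
Qed.

Let reC (e : R[i]) : 0 < e -> 0 < re e /\ (re e)%:C%C = e.
Proof.
by move=> e0; rewrite -ltcR RRe_real // ger0_real // ltW.
Qed.

Let re_le_norm (z : R[i]) : (re z) ^+ 2 <= re (`|z| ^+ 2).
Proof. by rewrite -add_Re2_Im2 /= lerDl sqr_ge0. Qed.

(** Minimise ||g i||^2 - 2 Re F i over D: a minimising sequence is Cauchy by the parallelogram law,
    and its limit represents F. The functional lives on an index space because it is typically given
    on operators x and only dominated by the norm of their class g x. *)
Lemma riesz_dense (I : lmodType R[i]) (D : set I) (g : I -> V) (F : I -> R[i])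
    (K : R[i]) :
  D !=set0 -> (forall a x y, D x -> D y -> D (a *: x + y)) ->
  (forall a x y, D x -> D y -> g (a *: x + y) = a *: g x + g y) ->
  (forall a x y, D x -> D y -> F (a *: x + y) = a * F x + F y) ->
  (forall x, D x -> `|F x| <= K * fnorm (g x)) ->
  exists2 z, (forall e : R[i], 0 < e -> exists2 i, D i & fnorm (g i - z) < e) &
    forall i, D i -> F i = f (g i) z.
Proof.
move=> [i0 Di0] Dlin glin Flin Fb.
have Kbound x : D x -> re (F x) ^+ 2 <= re (`|K| ^+ 2) * n2 (g x).
  move=> Dx; apply: le_trans (re_le_norm _) _.
  rewrite -lecR rmorphM /= n2E.
  have nr (z : R[i]) : (re (`|z| ^+ 2))%:C%C = `|z| ^+ 2.
    by rewrite RRe_real // realX // normr_real.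
  rewrite !nr -fnorm_sqr -exprMn ler_pXn2r ?nnegrE ?mulr_ge0 ?fnorm_ge0 //.
  have := Fb _ Dx; move=> h; apply: (le_trans h).
  (* A bound K that is not real forces ||g x|| = 0, since K ||g x|| dominates a norm. *)
  have [p|n] := boolP (K \is Num.real).
    by rewrite ler_wpM2r ?fnorm_ge0 // real_ler_norm.
  have [->|g0] := eqVneq (fnorm (g x)) 0; first by rewrite !mulr0.
  have : 0 <= K * fnorm (g x) by apply: le_trans h.
  rewrite pmulr_lge0 ?lt_def ?g0 ?fnorm_ge0 // => /ger0_real K0.
  by rewrite K0 in n.
pose q i := n2 (g i) - 2 * re (F i).
set k := re (`|K| ^+ 2) in Kbound.
have q_lb i : D i -> - k <= q i.
  move=> Di; have := Kbound _ Di; have := n2_ge0 (g i).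
  have k0 : 0 <= k by rewrite /k -add_Re2_Im2 addr_ge0 ?sqr_ge0.
  rewrite /q; move: (n2 _) (re _) => a r a0 h.
  suff : 2 * r <= k + a by lra.
  rewrite leNgt; apply/negP => h2.
  have : (k + a) ^+ 2 < (2 * r) ^+ 2.
    by rewrite ltr_pXn2r ?nnegrE //; lra.
  have := sqr_ge0 (k - a); nra.
pose E := q @` D.
have Einf : has_inf E.
  split; first by exists (q i0), i0.
  by exists (- k) => _ [i Di <-]; exact: q_lb.
pose m := inf E.
have mle i : D i -> m <= q i.
  by move=> Di; apply: ge_inf; [case: Einf | exists i].
have [u uP] : exists u : nat -> I, forall p, D (u p) /\ q (u p) < m + (p.+1%:R)^-1.
  suff /choice[u uP] p : exists i, D i /\ q i < m + (p.+1%:R)^-1 by exists u.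
  have p0 : 0 < (p.+1%:R)^-1 :> R by rewrite invr_gt0.
  by have [_ [i Di <-] h] := inf_adherent p0 Einf; exists i.
(* Parallelogram law, with the infimum m compared to q at the midpoint of i and j. *)
have n2B i j : D i -> D j -> n2 (g i - g j) <= 2 * (q i - m) + 2 * (q j - m).
  move=> Di Dj.
  have D0 : D 0 by have := Dlin (-1) _ _ Di Di; rewrite scaleN1r addNr.
  have g0 : g 0 = 0.
    by have := glin (-1) _ _ Di Di; rewrite !scaleN1r !addNr.
  have F0 : F 0 = 0.
    by have := Flin (-1) _ _ Di Di; rewrite scaleN1r mulN1r !addNr.
  have Dij : D (i + j) by have := Dlin 1 _ _ Di Dj; rewrite scale1r.
  have gij : g (i + j) = g i + g j.
    by have := glin 1 _ _ Di Dj; rewrite !scale1r.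
  have Fij : F (i + j) = F i + F j.
    by have := Flin 1 _ _ Di Dj; rewrite scale1r mul1r.
  pose h : R[i] := (2^-1)%:C%C.
  have Dh : D (h *: (i + j)) by have := Dlin h _ _ Dij D0; rewrite addr0.
  have := mle _ Dh; rewrite /q.
  have -> : g (h *: (i + j)) = h *: (g i + g j).
    by have := glin h _ _ Dij D0; rewrite !addr0 g0 addr0 gij.
  have -> : F (h *: (i + j)) = h * (F i + F j).
    by have := Flin h _ _ Dij D0; rewrite !addr0 F0 addr0 Fij.
  have reh z : re (h * z) = 2^-1 * re z.
    by rewrite /h; case: z => a b /=; rewrite mul0r subr0.
  have -> : n2 (h *: (g i + g j)) = 4^-1 * n2 (g i + g j).
    rewrite /n2 formZl formZr reh.
    have -> : h^* = h by apply: conj_Creal; rewrite /h complex_real.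
    by rewrite reh mulrA; congr (_ * _); field.
  rewrite reh reD.
  have : n2 (g i - g j) = 2 * n2 (g i) + 2 * n2 (g j) - n2 (g i + g j).
    rewrite /n2 !formBl !formBr !formDl !formDr !(reD, reN); ring.
  lra.
have cvg_inv (e : R) : 0 < e -> exists N, forall p, (N <= p)%N -> (p.+1%:R)^-1 < e.
  move=> e0; exists (Num.trunc e^-1); move=> p Np.
  rewrite invf_plt ?posrE //.
  apply: lt_le_trans (_ : (Num.trunc e^-1).+1%:R <= _).
    exact: truncnS_gt.
  by rewrite ler_nat.
have [] := fC (u := fun p => g (u p)).
  move=> e /reC[]; set r := re e => r0 <-.
  have r2 : 0 < r ^+ 2 / 4 by rewrite divr_gt0 // exprn_gt0.
  have [N NP] := cvg_inv _ r2; exists N => p p' Np Np'.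
  apply: fnorm_lt => //.
  have [[Dp qp] [Dp' qp']] := (uP p, uP p').
  have := n2B _ _ Dp Dp'; have := NP _ Np; have := NP _ Np'.
  move: qp qp'; set a := _^-1; set b := _^-1; lra.
move=> z zP; exists z.
  move=> e /zP[N /(_ N (leqnn N))]; exists (u N) => //.
  by have [] := uP N.
move=> j Dj; pose G := F j - f (g j) z.
suff G0 : G = 0 by apply/eqP; rewrite -subr_eq0 -/G G0.
pose a := re (`|G| ^+ 2); pose b := n2 (g j).
have aE : a%:C%C = G * G^*.
  by rewrite -normCK /a RRe_real // realX // normr_real.
(* First-order condition at the minimum in the direction t j, with t = s times the conjugate of the
   defect G. Since z may have no preimage in D, the comparison is made at u p and the error is sent
   to 0. *)
have ab s : 0 < s -> 2 * s * a <= s ^+ 2 * a * b.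
  move=> s0; rewrite -subr_ge0.
  pose t : R[i] := s%:C%C * G^*.
  have [c c0 cP] : exists2 c : R, 0 <= c & forall e : R, 0 < e -> exists2 p, q (u p) < m + e &
      `|re (t * (f (g j) (g (u p)) - f (g j) z))| <= c * e.
    have rr (x : R[i]) : `|re x|%:C%C <= `|x| by exact: normc_ge_Re.
    exists (re (`|t| * fnorm (g j))).
      rewrite -lecR RRe_real ?mulr_ge0 ?fnorm_ge0 //.
      by rewrite ger0_real ?mulr_ge0 ?fnorm_ge0.
    move=> e e0; have [N1 N1P] := cvg_inv _ e0.
    have [|N2 N2P] := zP e%:C%C; first by rewrite ltcR.
    exists (maxn N1 N2).
      have [_] := uP (maxn N1 N2); move/lt_trans; apply.
      by rewrite ltrD2l N1P // leq_maxl.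
    rewrite -formBr -lecR; apply: le_trans (rr _) _.
    rewrite rmorphM /= RRe_real; last first.
      by rewrite ger0_real ?mulr_ge0 ?fnorm_ge0.
    rewrite normrM -mulrA ler_wpM2l //.
    apply: le_trans (cauchy_schwarz _ _) _.
    by rewrite ler_wpM2l ?fnorm_ge0 // ltW // N2P // leq_maxr.
  rewrite -[0]add0r; apply/ler_addgt0Pl => e e0.
  (* The excess of q at u p costs e1 and the cross term costs 2 c e1, which add up to e. *)
  pose e1 := e / (1 + 2 * c).
  have e10 : 0 < e1 by rewrite divr_gt0 //; lra.
  have [p qp cp] := cP _ e10.
  have [Dp _] := uP p.
  have := mle _ (Dlin t _ _ Dj Dp).
  rewrite /q Flin // glin // /n2 !formDl !formDr !formZl !formZr.
  rewrite (form_conj fP (g j) (g (u p))) !reD.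
  have reJ (x : R[i]) : re x^* = re x by case: x.
  have -> : re (t^* * (f (g j) (g (u p)))^*) = re (t * f (g j) (g (u p))).
    by rewrite -rmorphM reJ.
  have -> : re (t * (t^* * f (g j) (g j))) = s ^+ 2 * a * b.
    rewrite -n2E -/b.
    have -> : t * (t^* * b%:C%C) = (s ^+ 2 * a * b)%:C%C; last by [].
    rewrite /t rmorphM /= conjCK !rmorphM /= aE.
    have -> : (s%:C%C)^* = s%:C%C by apply: conj_Creal; rewrite complex_real.
    by ring.
  have -> : re (t * F j) = re (t * f (g j) z) + s * a.
    rewrite -[F j](subrK (f (g j) z)) -/G mulrDr reD addrC; congr (_ + _).
    have -> : t * G = (s * a)%:C%C; last by [].
    by rewrite /t rmorphM /= aE; ring.
  move: qp cp; rewrite /q /n2 ler_norml mulrBr reD reN => qp /andP[_ cp].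
  have : e = e1 + 2 * (c * e1) by rewrite /e1; field; apply: lt0r_neq0; lra.
  lra.
have b0 : 0 <= b by exact: n2_ge0.
have a0 : a = 0.
  have a0 : 0 <= a by rewrite /a -add_Re2_Im2 addr_ge0 ?sqr_ge0.
  (* With s = 1 / (b + 1) one has s b <= 1, so [ab] gives 2 a <= a. *)
  have s0 : 0 < (b + 1)^-1 by rewrite invr_gt0 ltr_wpDl.
  have := ab _ s0.
  have -> : (b + 1)^-1 ^+ 2 * a * b = (b + 1)^-1 * (a * ((b + 1)^-1 * b)) by ring.
  have -> : 2 * (b + 1)^-1 * a = (b + 1)^-1 * (2 * a) by ring.
  rewrite ler_pM2l //.
  have : (b + 1)^-1 * b <= 1 by rewrite mulrC ler_pdivrMr; lra.
  move: (_ * b) => c c1 h; apply/le_anti; rewrite a0 andbT.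
  nra.
apply/eqP; rewrite -normr_eq0 -sqrf_eq0 normCK -aE a0; exact/eqP.
Qed.

End InnerProductSpaces.

(** * Hilbert spaces and their finite powers *)

Section HilbertSpaces.
Context {R : realType}.

Lemma hilbert_form (H : hilbert R) : inner_form (@ip R H).
Proof.
have [h1 h2 h3] := ipP H; split => // [x|x].
  by rewrite h3 exprn_ge0.
by rewrite h3 => /eqP; rewrite sqrf_eq0 normr_eq0 => /eqP.
Qed.

Lemma hilbert_norm (H : hilbert R) (x : H) : fnorm (@ip R H) x = `|x|.
Proof. by have [_ _ h] := ipP H; rewrite /fnorm h sqrCK. Qed.

Lemma ip_norm (H : hilbert R) (x : H) : ip x x = `|x| ^+ 2.
Proof. by have [_ _ h] := ipP H. Qed.

Lemma ip_le (H : hilbert R) (x y : H) : `|ip x y| <= `|x| * `|y|.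
Proof. by rewrite -!hilbert_norm; exact: cauchy_schwarz (hilbert_form H) _ _. Qed.

Lemma hilbert_cauchy (H : hilbert R) : cauchy_complete (@ip R H).
Proof.
move=> u uC.
have /cauchy_cvgP/cvg_ex[l ul] : cauchy (u @ \oo).
  apply/cauchy_ballP => e e0.
  have [N NP] := uC _ e0.
  exists (u @` [set p | (N <= p)%N], u @` [set p | (N <= p)%N]).
    split => /=; exists N => // p /= Np; by exists p.
  move=> [_ _] /= [[p Np <-] [q Nq <-]].
  by rewrite -ball_normE /= -hilbert_norm NP.
exists l => e e0.
have /cvgrPdist_lt/(_ _ e0)[N _ NP] := ul.
by exists N => p Np; rewrite hilbert_norm distrC; exact: NP.
Qed.

Lemma closure_normP (V : normedModType R[i]) (S : set V) v :
  closure S v <-> forall e : R[i], 0 < e -> exists2 s, S s & `|s - v| < e.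
Proof.
split=> [Sv e e0|Sv U].
  have [s [Ss]] := Sv _ (nbhsx_ballx v _ e0).
  by rewrite -ball_normE /= distrC; exists s.
move=> /nbhs_ballP[e /= e0 eU]; have [s Ss sv] := Sv _ e0.
by exists s; split => //; apply: eU; rewrite -ball_normE /= distrC.
Qed.

(** Only additivity of g is assumed, so that the lemma applies to the conjugate-linear [Jconj]. *)
Lemma closure_image (V W : normedModType R[i]) (g : V -> W) (C : R[i])
    (S : set V) (T : set W) v :
  {morph g : x y / x - y} -> 0 <= C -> (forall u, `|g u| <= C * `|u|) ->
  (forall u, S u -> closure T (g u)) -> closure S v -> closure T (g v).
Proof.
move=> gB C0 gC ST /closure_normP Sv; apply/closure_normP => e e0.
have C1 : 0 < C + 1 by rewrite ltr_wpDl.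
have e2 : 0 < e / 2 by rewrite divr_gt0.
have [s Ss] := Sv (e / 2 / (C + 1)) (divr_gt0 e2 C1).
rewrite ltr_pdivlMr // => sv.
have /closure_normP/(_ _ e2)[t Tt ts] := ST _ Ss.
exists t => //; rewrite -[t - _](subrKA (g s)).
apply: le_lt_trans (ler_normD _ _) _.
rewrite [e]splitr ltrD // -gB; apply: le_lt_trans (gC _) _.
by apply: le_lt_trans sv; rewrite mulrC ler_wpM2l // lerDl.
Qed.

Lemma dense_eq0 (V W : normedModType R[i]) (g : V -> W) (C : R[i]) (S : set V) v :
  {morph g : x y / x - y} -> 0 <= C -> (forall u, `|g u| <= C * `|u|) ->
  (forall u, S u -> g u = 0) -> closure S v -> g v = 0.
Proof.
move=> gB C0 gC Sg Sv.
have : closure [set (0 : W)] (g v).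
  apply: (closure_image gB C0 gC) Sv => u /Sg ->.
  by apply: subset_closure.
move=> /closure_normP h; apply/eqP; rewrite -normr_eq0; apply/eqP/le_anti.
rewrite normr_ge0 andbT; apply/ler_addgt0Pl => e e0; rewrite addr0.
by have [s ->] := h _ e0; rewrite sub0r normrN => /ltW.
Qed.

Lemma bounded_op_bound (H : hilbert R) (T : H -> H) : bounded_op T ->
  exists2 C : R[i], 0 <= C & forall v, `|T v| <= C * `|v|.
Proof.
move=> [Tl Tc].
pose T' := GRing.isLinear.Build _ _ _ _ T Tl.
pose Tlin : {linear H -> H} := HB.pack T T'.
have /linear_boundedP[r [rr rP]] : bounded_near Tlin (nbhs 0).
  by apply/continuous_linear_bounded; exact: Tc.
exists (`|r| + 1); first by rewrite addr_ge0.
move=> v; apply: rP.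
by rewrite (le_lt_trans (real_ler_norm rr)) // ltrDl.
Qed.

Section FinitePower.
Context {H : hilbert R} {n : nat}.
Implicit Types u v w : 'I_n -> H.

Lemma ipn_form : inner_form (@ipn R H n).
Proof.
have hf := hilbert_form H.
split=> [a x y z|x y|x|x].
- rewrite /ipn mulr_sumr -big_split /=; apply: eq_bigr => i _.
  exact: form_lin hf _ _ _ _.
- by rewrite /ipn rmorph_sum /=; apply: eq_bigr => i _; exact: form_conj.
- by rewrite /ipn sumr_ge0 // => i _; exact: form_ge0.
- move=> /eqP; rewrite /ipn psumr_eq0; last by move=> i _; exact: form_ge0.
  move=> /allP h; apply/funext => i; apply: (form_def hf).
  by apply/eqP/h; rewrite mem_index_enum.
Qed.

Lemma normn_coord u i : `|u i| <= normn u.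
Proof.
rewrite -(@ler_pXn2r _ 2) ?nnegrE ?normr_ge0 ?(fnorm_ge0 ipn_form) //.
rewrite sqrtCK -ip_norm /ipn (bigD1 i) //= lerDl sumr_ge0 // => j _.
exact: form_ge0 (hilbert_form H) _.
Qed.

Lemma normn_sum u : normn u <= \sum_i `|u i|.
Proof.
rewrite -(@ler_pXn2r _ 2) ?nnegrE ?sumr_ge0 ?(fnorm_ge0 ipn_form) //.
rewrite sqrtCK /ipn expr2 mulr_suml; apply: ler_sum => i _.
rewrite ip_norm expr2 ler_wpM2l // (bigD1 i) //= lerDl.
by rewrite sumr_ge0.
Qed.

Lemma ipn_cauchy : cauchy_complete (@ipn R H n).
Proof.
move=> u uC.
have /choice[l lP] i : exists l : H, forall e : R[i], 0 < e ->
    exists N, forall p, (N <= p)%N -> `|u p i - l| < e.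
  have [] := @hilbert_cauchy H (fun p => u p i).
    move=> e /uC[N NP]; exists N => p q Np Nq; rewrite hilbert_norm.
    exact: le_lt_trans (normn_coord (u p - u q) i) (NP _ _ Np Nq).
  by move=> l lP; exists l => e /lP[N NP]; exists N => p /NP; rewrite hilbert_norm.
exists l => e e0.
(* Dividing by [n.+1] covers n = 0 and keeps the sum of n such errors strictly below e. *)
have e1 : 0 < e / n.+1%:R by rewrite divr_gt0.
have /choice[N NP] i := lP i _ e1.
exists (\max_i N i)%N => p Np.
apply: le_lt_trans (normn_sum _) _.
apply: (@le_lt_trans _ _ (\sum_(i < n) e / n.+1%:R)).
  apply: ler_sum => i _; apply: ltW; apply: NP.
  exact: leq_trans (leq_bigmax _) Np.
rewrite sumr_const card_ord -[_ *+ n]mulr_natr mulrAC ltr_pdivrMr //.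
by rewrite ltr_pM2l // ltr_nat.
Qed.

(** Closedness is spelled out with [normn], the norm in which [closed_Der11] takes its closure. *)
Definition closed_subspace (V : set ('I_n -> H)) : Prop :=
  [/\ V 0, forall (a : R[i]) u v, V u -> V v -> V (a *: u + v) &
    forall u, (forall e : R[i], 0 < e -> exists2 v, V v & normn (v - u) < e) ->
      V u].

Section Projection.
Variable V : set ('I_n -> H).
Hypothesis V_closed : closed_subspace V.

Let V0 : V 0. Proof. by case: V_closed. Qed.

Let Vlin a u v : V u -> V v -> V (a *: u + v).
Proof. by case: V_closed => _ + _; apply. Qed.

Let VB u v : V u -> V v -> V (u - v).
Proof. by move=> Vu Vv; rewrite addrC -scaleN1r; exact: Vlin. Qed.

Lemma projP u : V (Defs.proj V u) /\ forall v, V v -> ipn (u - Defs.proj V u) v = 0.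
Proof.
suff : exists w, V w /\ forall v, V v -> ipn (u - w) v = 0.
  exact: xgetPex.
have [|||||z zV zP] := riesz_dense (D := V) (g := id)
  (F := fun v => ipn v u) (K := normn u) ipn_form ipn_cauchy.
- by exists 0.
- exact: Vlin.
- by [].
- by move=> a x y _ _; exact: form_lin ipn_form _ _ _ _.
- by move=> x _; rewrite mulrC; exact: cauchy_schwarz ipn_form _ _.
exists z; split; first by case: V_closed => _ _; apply.
move=> v Vv; rewrite (form_conj ipn_form) (formBr ipn_form) zP // subrr.
exact: rmorph0.
Qed.

Lemma proj_uniq u w : V w -> (forall v, V v -> ipn (u - w) v = 0) -> Defs.proj V u = w.
Proof.
move=> Vw wP; have [Vp pP] := projP u.
apply/eqP; rewrite -subr_eq0; apply/eqP/(form_def ipn_form).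
have VB' := VB Vp Vw.
have {1}-> : Defs.proj V u - w = (u - w) - (u - Defs.proj V u).
  by rewrite opprB [RHS]addrC subrKA.
by rewrite (formBl ipn_form) wP // pP // subrr.
Qed.

Lemma proj_id v : V v -> Defs.proj V v = v.
Proof.
by move=> Vv; apply: proj_uniq => // w _; rewrite subrr (form0l ipn_form).
Qed.

Lemma proj_linear : linear (Defs.proj V).
Proof.
move=> a u v; have [Vu uP] := projP u; have [Vv vP] := projP v.
apply: proj_uniq; first exact: Vlin.
move=> w Vw; have -> : a *: u + v - (a *: Defs.proj V u + Defs.proj V v) =
    a *: (u - Defs.proj V u) + (v - Defs.proj V v).
  by rewrite scalerBr opprD addrACA.
by rewrite (form_lin ipn_form) uP // vP // mulr0 addr0.
Qed.

Lemma normn_proj u : normn (Defs.proj V u) <= normn u.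
Proof.
have [Vu uP] := projP u; set p := Defs.proj V u in Vu uP *.
have [p0|p0] := eqVneq (normn p) 0; first by rewrite p0 (fnorm_ge0 ipn_form).
have pp : 0 < normn p by rewrite lt_def p0 (fnorm_ge0 ipn_form).
rewrite -(ler_pM2r pp) -expr2 (fnorm_sqr (@ipn R H n)).
have -> : ipn p p = ipn u p.
  by apply/esym/eqP; rewrite -subr_eq0 -(formBl ipn_form) uP.
apply: le_trans (cauchy_schwarz ipn_form _ _).
by apply: real_ler_norm; rewrite -[u](subrK p) (formDl ipn_form) uP // add0r
  ger0_real // (form_ge0 ipn_form).
Qed.

End Projection.
End FinitePower.
End HilbertSpaces.

(** * The standard representation and the modular conjugation *)

Section Adjoints.
Context {R : realType} {H : hilbert R}.
Implicit Types (x y : H -> H) (A : set (H -> H)).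
Let hf := hilbert_form H.

Lemma adjoint_sym x y : is_adjoint x y -> is_adjoint y x.
Proof.
by move=> xy u v; rewrite (form_conj hf) -xy -(form_conj hf).
Qed.

Lemma adjoint_uniq x y y' : is_adjoint x y -> is_adjoint x y' -> y = y'.
Proof.
move=> xy xy'; apply/funext => v; apply/eqP; rewrite -subr_eq0; apply/eqP.
by apply: (form_def hf); rewrite (formBr hf) -xy -xy' subrr.
Qed.

(** The adjoint as a total function, with value 0 on maps that have none; this lets adjoints appear
    in formulas. *)
Definition star x : H -> H := xget 0 [set y | is_adjoint x y].

Lemma star_eq x y : is_adjoint x y -> star x = y.
Proof.
move=> xy; apply: (adjoint_uniq _ xy).
by apply: (@xgetPex _ 0 [set z | is_adjoint x z]); exists y.
Qed.

Section Subalgebra.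
Variable A : set (H -> H).
Hypothesis hA : unital_star_subalgebra A.

Lemma star_adj x : A x -> is_adjoint x (star x).
Proof. by move=> /(ussa_star hA)[y _ xy]; rewrite (star_eq xy). Qed.

Lemma ussa_starE x : A x -> A (star x).
Proof. by move=> /(ussa_star hA)[y Ay xy]; rewrite (star_eq xy). Qed.

Lemma starK x : A x -> star (star x) = x.
Proof. by move=> Ax; apply/star_eq/adjoint_sym/star_adj. Qed.

Lemma starM x y : A x -> A y -> star (x \o y) = star y \o star x.
Proof.
by move=> Ax Ay; apply: star_eq => u v /=; rewrite !star_adj.
Qed.

Lemma starDZ (a : R[i]) x y : A x -> A y ->
  star (a *: x + y) = a^* *: star x + star y.
Proof.
move=> Ax Ay; apply: star_eq => u v.
rewrite (formDl hf) (formZl hf) (formDr hf) (formZr hf) conjCK.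
by rewrite !star_adj.
Qed.

Lemma ussa0 : A 0.
Proof. by have := ussa_scale hA 0 (ussa_id hA); rewrite scale0r. Qed.

Lemma ussa_lin (a : R[i]) x y : A x -> A y -> A (a *: x + y).
Proof. by move=> Ax Ay; apply: ussa_add hA _ _ _ Ay; exact: ussa_scale. Qed.

Lemma ussaN x : A x -> A (- x).
Proof. by move=> Ax; rewrite -scaleN1r; exact: ussa_scale. Qed.

Lemma ussa_sum n (F : 'I_n -> H -> H) : (forall i, A (F i)) -> A (\sum_i F i).
Proof.
by move=> AF; elim/big_ind: _ => //; [exact: ussa0|exact: ussa_add].
Qed.

Lemma ussa_compDr (a : R[i]) x y z : A x ->
  x \o (a *: y + z) = a *: (x \o y) + (x \o z).
Proof.
move=> /(ussa_bounded hA)[xl _]; apply/funext => v /=.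
by rewrite [LHS]xl.
Qed.

Lemma ussa_comp_sumr n x (F : 'I_n -> H -> H) : A x ->
  x \o (\sum_i F i) = \sum_i (x \o F i).
Proof.
move=> Ax; apply: (big_ind2 (fun a b => x \o a = b)) => //.
  by have := ussa_compDr 0 0 0 Ax; rewrite scale0r addr0 scale0r add0r => h;
     have := ussa_compDr 1 0 0 Ax; rewrite !scale1r addr0 => {}h;
     apply: (addrI (x \o 0)); rewrite addr0 -h.
move=> y1 z1 y2 z2 <- <-.
by have := ussa_compDr 1 y1 y2 Ax; rewrite !scale1r.
Qed.

End Subalgebra.

Lemma comp_suml n x (F : 'I_n -> H -> H) : (\sum_i F i) \o x = \sum_i (F i \o x).
Proof. by apply: (big_ind2 (fun a b => a \o x = b)) => // ? ? ? ? <- <-. Qed.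

End Adjoints.

Lemma vN_ussa (R : realType) (N : tracialVN R) : unital_star_subalgebra (vN_alg N).
Proof. by have [] := vN_algP N. Qed.
#[local] Hint Resolve vN_ussa : core.

(** * The trace representation, the conjugation J and right multiplication *)

Section GNS.
Context {R : realType} {N : tracialVN R} (L : gns N).
Let Q := vN_alg N.
Let hf := hilbert_form L.
Let hQ : unital_star_subalgebra Q := vN_ussa N.
Implicit Types (a b p q : N -> N) (u v : L).

Lemma hatDZ (c : R[i]) p q : Q p -> Q q ->
  hat L (c *: p + q) = c *: hat L p + hat L q.
Proof. by move=> Qp Qq; rewrite /hat (rep_linear (gnsP L)). Qed.

Lemma hatD p q : Q p -> Q q -> hat L (p + q) = hat L p + hat L q.
Proof. by move=> Qp Qq; have := hatDZ 1 Qp Qq; rewrite !scale1r. Qed.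

Lemma lmul_hat p q : Q p -> Q q -> lmul L p (hat L q) = hat L (p \o q).
Proof. by move=> Qp Qq; rewrite /hat (rep_mul (gnsP L)). Qed.

Lemma lmul_star p u v : Q p -> ip (lmul L p u) v = ip u (lmul L (star p) v).
Proof.
move=> Qp; apply: (rep_star (gnsP L)) => //; first exact: ussa_starE.
exact: star_adj.
Qed.

Lemma ip_hat p q : Q p -> Q q -> ip (hat L p) (hat L q) = vN_tr N (star q \o p).
Proof.
move=> Qp Qq; have Qq' := ussa_starE hQ Qq.
rewrite -(rep_trace (gnsP L)); last exact: ussa_mul.
by rewrite (form_conj hf) {1}/hat lmul_star // -(form_conj hf) lmul_hat.
Qed.

(** This is traciality; it makes the adjoint isometric for the trace norm, hence J well defined. *)
Lemma ip_hat_star p q : Q p -> Q q ->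
  ip (hat L (star p)) (hat L (star q)) = ip (hat L q) (hat L p).
Proof.
move=> Qp Qq; have Qp' := ussa_starE hQ Qp; have Qq' := ussa_starE hQ Qq.
by rewrite !ip_hat // (starK hQ Qq) (fnts_tracial (vN_trP N)).
Qed.

Lemma hat_star_norm p : Q p -> `|hat L (star p)| = `|hat L p|.
Proof.
move=> Qp; apply: (@pexpIrn _ 2) => //; rewrite ?nnegrE //.
by rewrite -!ip_norm ip_hat_star.
Qed.

Lemma hat_dense v : closure [set hat L x | x in Q] v.
Proof. by have := rep_cyclic (gnsP L); rewrite -/Q => ->. Qed.
Arguments hat_dense : clear implicits.

Lemma hat_sep v : (forall p, Q p -> ip (hat L p) v = 0) -> v = 0.
Proof.
move=> hv; apply: (form_def hf).
apply: (form_dense0 hf (S := [set hat L x | x in Q])) => [e e0|_ [p Qp <-]].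
  have /closure_normP/(_ _ e0)[s Ss sv] := hat_dense v.
  by exists s; rewrite // hilbert_norm.
exact: hv.
Qed.

Lemma lmulB p u v : Q p -> lmul L p (u - v) = lmul L p u - lmul L p v.
Proof.
move=> /(rep_bounded (gnsP L))[lin _].
by rewrite addrC -scaleN1r [LHS]lin scaleN1r addrC.
Qed.

Lemma lmulDZ p (c : R[i]) u v : Q p ->
  lmul L p (c *: u + v) = c *: lmul L p u + lmul L p v.
Proof. by move=> /(rep_bounded (gnsP L))[lin _]; exact: lin. Qed.

Lemma lmul_bound p : Q p ->
  exists2 C : R[i], 0 <= C & forall u, `|lmul L p u| <= C * `|u|.
Proof. by move=> /(rep_bounded (gnsP L))/bounded_op_bound. Qed.

(* The modular conjugation: [Jconj (hat L a) = hat L (star a)]. *)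
Definition Jconj u : L :=
  xget 0 [set v | forall a, Q a -> ip (hat L a) v = ip u (hat L (star a))].

(** The right-hand side is linear in a, being conjugated twice, and bounded by ||u|| ||hat a||, so
    Riesz applies. Defining J by this duality gives it on all vectors at once. *)
Lemma JconjP u a : Q a -> ip (hat L a) (Jconj u) = ip u (hat L (star a)).
Proof.
suff : exists v, forall a, Q a -> ip (hat L a) v = ip u (hat L (star a)).
  by move=> /(xgetPex 0); apply.
have [|||||v _ vP] := riesz_dense (D := Q) (g := hat L)
  (F := fun a => ip u (hat L (star a))) (K := `|u|) hf (hilbert_cauchy (H := L)).
- by exists id; exact: (ussa_id hQ).
- by move=> *; exact: ussa_lin.
- by move=> *; exact: hatDZ.
- move=> c x y Qx Qy; rewrite (starDZ hQ) // hatDZ; try exact: ussa_starE.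
  by rewrite (formDr hf) (formZr hf) conjCK.
- move=> x Qx; rewrite hilbert_norm -(hat_star_norm Qx); exact: ip_le.
by exists v => b Qb; rewrite vP.
Qed.

Lemma Jconj_uniq u v :
  (forall a, Q a -> ip (hat L a) v = ip u (hat L (star a))) -> Jconj u = v.
Proof.
move=> vP; apply/eqP; rewrite -subr_eq0; apply/eqP/hat_sep => p Qp.
by rewrite (formBr hf) JconjP // vP // subrr.
Qed.

Lemma Jconj_hat p : Q p -> Jconj (hat L p) = hat L (star p).
Proof.
move=> Qp; apply: Jconj_uniq => a Qa.
by rewrite -(ip_hat_star (ussa_starE hQ Qp)) ?(starK hQ) //; exact: ussa_starE.
Qed.

Lemma JconjDZ (c : R[i]) u v : Jconj (c *: u + v) = c^* *: Jconj u + Jconj v.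
Proof.
apply: Jconj_uniq => a Qa; rewrite (formDr hf) (formZr hf) conjCK !JconjP //.
by rewrite (form_lin hf).
Qed.

Lemma JconjD u v : Jconj (u + v) = Jconj u + Jconj v.
Proof. by have := JconjDZ 1 u v; rewrite rmorph1 !scale1r. Qed.

Lemma JconjB u v : Jconj (u - v) = Jconj u - Jconj v.
Proof. by rewrite addrC -scaleN1r JconjDZ rmorphN1 scaleN1r addrC. Qed.

Lemma JconjK u : Jconj (Jconj u) = u.
Proof.
apply: Jconj_uniq => a Qa.
rewrite (form_conj hf) -[X in ip u (hat L X)](starK hQ Qa).
by rewrite -JconjP -?(form_conj hf) //; exact: ussa_starE.
Qed.

Lemma Jconj_norm u : `|Jconj u| = `|u|.
Proof.
suff le w : `|Jconj w| <= `|w|.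
  by apply/le_anti; rewrite le andTb -{1}(JconjK u) le.
have h : `|ip (Jconj w) (Jconj w)| <= `|w| * `|Jconj w|.
  apply/ler_addgt0Pl => e e0.
  pose c := `|Jconj w| + `|w| + 1.
  have c0 : 0 < c by rewrite ltr_wpDl // addr_ge0.
  (* Replace one copy of J w by a nearby [hat L a], where [JconjP] and the isometry of the adjoint
     apply. The constant c keeps the total error (||w|| + ||J w||) e / c below e. *)
  have /closure_normP/(_ _ (divr_gt0 e0 c0))[_ [a Qa <-] ae] := hat_dense (Jconj w).
  rewrite -[X in ip X _](subKr (hat L a)) (formBl hf).
  apply: le_trans (ler_normB _ _) _.
  rewrite JconjP //.
  have h1 : `|ip w (hat L (star a))| <= `|w| * (`|Jconj w| + e / c).
    apply: le_trans (ip_le _ _) _; rewrite ler_wpM2l // hat_star_norm //.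
    rewrite -(subrK (Jconj w) (hat L a)) addrC.
    by apply: le_trans (ler_normD _ _) _; rewrite lerD2l ltW.
  have h2 : `|ip (hat L a - Jconj w) (Jconj w)| <= e / c * `|Jconj w|.
    by apply: le_trans (ip_le _ _) _; rewrite ler_wpM2r // ltW.
  apply: le_trans (lerD h1 h2) _.
  have -> : `|w| * (`|Jconj w| + e / c) + e / c * `|Jconj w| =
    (`|w| + `|Jconj w|) * (e / c) + `|w| * `|Jconj w| by ring.
  rewrite lerD2r mulrCA ger_pMr // ler_pdivrMr // mul1r /c addrC lerDl; exact: ler01.
have [->|J0] := eqVneq (Jconj w) 0; first by rewrite normr0.
have Jp : 0 < `|Jconj w| by rewrite normr_gt0.
by move: h; rewrite ip_norm ger0_norm ?exprn_ge0 // expr2 ler_pM2r.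
Qed.

Lemma Jconj_ip u v : ip (Jconj u) (Jconj v) = ip v u.
Proof.
apply/eqP; rewrite -subr_eq0; apply/eqP.
suff : (ip (Jconj u) (Jconj v) - ip v u)^* = 0 :> R[i]^o.
  by move=> /eqP; rewrite conjC_eq0 => /eqP.
apply: (@dense_eq0 R L R[i]^o (fun u => (ip (Jconj u) (Jconj v) - ip v u)^*)
  (`|v| + `|v|) [set hat L x | x in Q]); last exact: hat_dense.
- move=> x y; rewrite JconjB (formBl hf) (formBr hf) -rmorphB /=.
  by congr (_^*); ring.
- by rewrite addr_ge0.
- move=> x; rewrite norm_conjC mulrDl; apply: le_trans (ler_normB _ _) _.
  rewrite lerD //; apply: le_trans (ip_le _ _) _ => //.
  by rewrite !Jconj_norm mulrC.
- move=> _ [p Qp <-]; rewrite Jconj_hat // JconjP; last exact: ussa_starE.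
  by rewrite (starK hQ) // subrr rmorph0.
Qed.

(** Right multiplication by a in the form J a^* J, bounded on the whole space; [ract_hat] identifies
    it on classes of operators. *)
Definition ract a u : L := Jconj (lmul L (star a) (Jconj u)).

Lemma ract_hat a p : Q a -> Q p -> ract a (hat L p) = hat L (p \o a).
Proof.
move=> Qa Qp; have Qa' := ussa_starE hQ Qa; have Qp' := ussa_starE hQ Qp.
rewrite /ract Jconj_hat // lmul_hat // Jconj_hat; last exact: ussa_mul.
by rewrite (starM hQ) // !(starK hQ).
Qed.

Lemma ractDZ a (c : R[i]) u v : Q a ->
  ract a (c *: u + v) = c *: ract a u + ract a v.
Proof.
by move=> Qa; rewrite /ract JconjDZ lmulDZ ?JconjDZ ?conjCK //; exact: ussa_starE.
Qed.

Lemma ractB a u v : Q a -> ract a (u - v) = ract a u - ract a v.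
Proof. by move=> Qa; rewrite addrC -scaleN1r ractDZ // scaleN1r addrC. Qed.

Lemma ract_bound a : Q a ->
  exists2 C : R[i], 0 <= C & forall u, `|ract a u| <= C * `|u|.
Proof.
move=> /(ussa_starE hQ)/lmul_bound[C C0 CP]; exists C => // u.
by rewrite /ract Jconj_norm -(Jconj_norm u).
Qed.

Lemma ract_adj a u v : Q a -> ip (ract a u) v = ip u (ract (star a) v).
Proof.
move=> Qa; have Qa' := ussa_starE hQ Qa.
rewrite /ract -{1}(JconjK v) Jconj_ip (starK hQ) // -{2}(JconjK u) Jconj_ip.
by rewrite lmul_star.
Qed.

(** On classes of operators this is associativity; both sides are bounded, so it extends by
    density. *)
Lemma lmul_ract a b u : Q a -> Q b -> lmul L b (ract a u) = ract a (lmul L b u).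
Proof.
move=> Qa Qb; apply/eqP; rewrite -subr_eq0; apply/eqP.
have [C1 C10 C1P] := lmul_bound Qb; have [C2 C20 C2P] := ract_bound Qa.
apply: (@dense_eq0 R L L (fun u => lmul L b (ract a u) - ract a (lmul L b u))
  (C1 * C2 + C2 * C1) [set hat L x | x in Q]); last exact: hat_dense.
- move=> x y; rewrite !(lmulB, ractB) //.
  by rewrite !opprD !opprK addrACA.
- by rewrite addr_ge0 ?mulr_ge0.
- move=> x; rewrite mulrDl -!mulrA; apply: le_trans (ler_normB _ _) _.
  apply: lerD.
    by apply: le_trans (C1P _) _; rewrite ler_wpM2l.
  by apply: le_trans (C2P _) _; rewrite ler_wpM2l.
- move=> _ [p Qp <-].
  rewrite ract_hat // lmul_hat //; last exact: ussa_mul.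
  by rewrite lmul_hat // ract_hat ?subrr //; exact: ussa_mul.
Qed.

End GNS.

(** * The coarse bimodule *)

Section Tensor.
Context {R : realType} {M : tracialVN R} {Mo : opposite M}
  {E : vN_tensor M Mo} (LM : gns M) (LE : gns E).
Let QM := vN_alg M.
Let QE := vN_alg E.
Let hQM : unital_star_subalgebra QM := vN_ussa M.
Let hQE : unital_star_subalgebra QE := vN_ussa E.
Let hQo : unital_star_subalgebra (vN_alg Mo) := vN_ussa Mo.
Let hE := hilbert_form (vNt_space E).
Let hL := hilbert_form LE.
Implicit Types (x y z : M -> M) (xi eta : LE).
Let oP := oppP Mo.
Let tP := tensorP (vNt_space E).
Notation tens := (tens (vNt_space E)).
Notation tensor_opp := (@tensor_opp R M Mo E).

Lemma opp_alg y : QM y -> vN_alg Mo (Defs.opp Mo y).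
Proof. by case: (op_bij oP) => h _ _; exact: h. Qed.

(** By surjectivity id is the image of some y, and anti-multiplicativity applied to y = y id shows
    that the image of id is a unit for it. *)
Lemma opp_id : Defs.opp Mo id = id.
Proof.
have [_ _ /(_ id (ussa_id hQo))[y Qy yid]] := op_bij oP.
by have := op_mul oP Qy (ussa_id hQM); rewrite yid => ->.
Qed.

Let bM x : QM x -> bounded_op x. Proof. exact: (ussa_bounded hQM). Qed.
Let bO x : QM x -> bounded_op (Defs.opp Mo x).
Proof. by move/opp_alg; exact: (ussa_bounded hQo). Qed.

Lemma tensor_opp_tens x y u v : QM x -> QM y ->
  tensor_opp x y (tens u v) = tens (x u) (Defs.opp Mo y v).
Proof. by move=> Qx Qy; apply: (otens_tens tP); [exact: bM|exact: bO]. Qed.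

Lemma tensor_opp_alg x y : QM x -> QM y -> QE (tensor_opp x y).
Proof.
move=> Qx Qy; split.
  by apply: (otens_bounded tP); [exact: bM|exact: bO].
move=> S [_ SP]; rewrite SP //; exists x, (Defs.opp Mo y); split => //.
exact: opp_alg.
Qed.

Lemma tensor_sep (w : vNt_space E) : (forall u v, ip (tens u v) w = 0) -> w = 0.
Proof.
move=> hw; apply: (form_def hE).
apply: (form_dense0 hE (S := [set w | exists (n : nat) (u : 'I_n -> M)
    (v : 'I_n -> Mo), w = \sum_(i < n) tens (u i) (v i)])) => [e e0|_ [n [u [v ->]]]].
  have : setT w by []; rewrite -(tens_dense tP) => /closure_normP/(_ _ e0)[s Ss sw].
  by exists s; rewrite // hilbert_norm.
apply: (big_ind (fun s => ip s w = 0)) => [|s t hs ht|i _]; last exact: hw.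
  exact: (form0l hE).
by rewrite (formDl hE) hs ht addr0.
Qed.

(** Passing to adjoints turns agreement on elementary tensors into agreement of S^* w and T^* w when
    paired with these tensors, which separate vectors. *)
Lemma tensor_op_ext (S T : vNt_space E -> vNt_space E) : QE S -> QE T ->
  (forall u v, S (tens u v) = T (tens u v)) -> S = T.
Proof.
move=> QS QT ST; rewrite -(starK hQE QS) -(starK hQE QT); congr star.
apply/funext => w; apply/eqP; rewrite -subr_eq0; apply/eqP/tensor_sep => u v.
rewrite (formBr hE) -(star_adj hQE QS) -(star_adj hQE QT) ST subrr //.
Qed.

Lemma tensor_opp_id : tensor_opp id id = id.
Proof.
apply: tensor_op_ext => [||u v]; first by apply: tensor_opp_alg; exact: ussa_id.
  exact: ussa_id.
by rewrite tensor_opp_tens ?opp_id //; exact: (ussa_id hQM).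
Qed.

Lemma tensor_oppM x y x' y' : QM x -> QM y -> QM x' -> QM y' ->
  tensor_opp x y \o tensor_opp x' y' = tensor_opp (x \o x') (y' \o y).
Proof.
move=> Qx Qy Qx' Qy'; have Qxx := ussa_mul hQM Qx Qx'.
have Qyy := ussa_mul hQM Qy' Qy.
apply: tensor_op_ext => [||u v]; last first.
- by rewrite /= !tensor_opp_tens // (op_mul oP).
- exact: tensor_opp_alg.
- by apply: (ussa_mul hQE); exact: tensor_opp_alg.
Qed.

Lemma tensor_oppDZl (a : R[i]) x x' y : QM x -> QM x' -> QM y ->
  tensor_opp (a *: x + x') y = a *: tensor_opp x y + tensor_opp x' y.
Proof.
move=> Qx Qx' Qy; have Qxx := ussa_lin hQM a Qx Qx'.
apply: tensor_op_ext => [||u v]; last first.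
- rewrite [RHS]/GRing.add /= [in RHS]/GRing.scale /= !tensor_opp_tens //.
  exact: (tens_linearl tP).
- by apply: (ussa_lin hQE); exact: tensor_opp_alg.
- exact: tensor_opp_alg.
Qed.

Lemma tensor_oppDZr (a : R[i]) x y y' : QM x -> QM y -> QM y' ->
  tensor_opp x (a *: y + y') = a *: tensor_opp x y + tensor_opp x y'.
Proof.
move=> Qx Qy Qy'; have Qyy := ussa_lin hQM a Qy Qy'.
apply: tensor_op_ext => [||u v]; last first.
- rewrite [RHS]/GRing.add /= [in RHS]/GRing.scale /= !tensor_opp_tens //.
  by rewrite (op_linear oP) //; exact: (tens_linearr tP).
- by apply: (ussa_lin hQE); exact: tensor_opp_alg.
- exact: tensor_opp_alg.
Qed.

Lemma star_tensor_opp x y : QM x -> QM y ->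
  star (tensor_opp x y) = tensor_opp (star x) (star y).
Proof.
move=> Qx Qy; have Qx' := ussa_starE hQM Qx; have Qy' := ussa_starE hQM Qy.
have QT := tensor_opp_alg Qx Qy.
apply: tensor_op_ext => [||u v]; [exact: ussa_starE|exact: tensor_opp_alg|].
apply/eqP; rewrite -subr_eq0; apply/eqP/tensor_sep => u' v'.
rewrite (formBr hE) -(star_adj hQE QT) !tensor_opp_tens // !(tens_ip tP).
rewrite (star_adj hQM Qx).
by rewrite (op_star oP Qy Qy' (star_adj hQM Qy)) subrr.
Qed.

Lemma tr_tensor_opp x y : QM x -> QM y ->
  vN_tr E (tensor_opp x y) = vN_tr M x * vN_tr M y.
Proof.
move=> Qx Qy; rewrite [LHS](vNt_trE E) //; last exact: opp_alg.
by rewrite (op_trace oP).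
Qed.

Lemma hat_id_norm : `|hat LM id| = 1.
Proof.
apply: (@pexpIrn _ 2) => //; rewrite ?nnegrE //.
rewrite -ip_norm expr1n ip_hat; try exact: (ussa_id hQM).
rewrite (_ : star id \o id = id) ?(fnts_unit (vN_trP M)) //.
by apply: star_eq.
Qed.

(** The trace factors on elementary tensors; the reversed product in the opposite factor yields
    tau(y y^* ), which traciality turns into tau(y^* y). *)
Lemma hat_tensor_opp_norm x y : QM x -> QM y ->
  `|hat LE (tensor_opp x y)| = `|hat LM x| * `|hat LM y|.
Proof.
move=> Qx Qy; have Qx' := ussa_starE hQM Qx; have Qy' := ussa_starE hQM Qy.
apply: (@pexpIrn _ 2) => //; rewrite ?nnegrE ?mulr_ge0 //.
rewrite exprMn -!ip_norm !ip_hat //; last exact: tensor_opp_alg.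
rewrite star_tensor_opp // tensor_oppM // tr_tensor_opp //.
- by congr (_ * _); exact: (fnts_tracial (vN_trP M)).
- exact: (ussa_mul hQM).
- exact: (ussa_mul hQM).
- exact: tensor_opp_alg.
Qed.

Section Bimodule.
Local Notation bimod := (@bimod R M Mo E LE).

Lemma bimodDZ (a : R[i]) x y xi eta : QM x -> QM y ->
  bimod x (a *: xi + eta) y = a *: bimod x xi y + bimod x eta y.
Proof. by move=> Qx Qy; rewrite /bimod lmulDZ //; exact: tensor_opp_alg. Qed.

Lemma bimodD x y xi eta : QM x -> QM y ->
  bimod x (xi + eta) y = bimod x xi y + bimod x eta y.
Proof. by move=> Qx Qy; have := bimodDZ 1 xi eta Qx Qy; rewrite !scale1r. Qed.

Lemma bimodB x y xi eta : QM x -> QM y ->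
  bimod x (xi - eta) y = bimod x xi y - bimod x eta y.
Proof. by move=> Qx Qy; rewrite /bimod lmulB //; exact: tensor_opp_alg. Qed.

Lemma bimod0 x y : QM x -> QM y -> bimod x 0 y = 0.
Proof. by move=> Qx Qy; have := bimodB 0 0 Qx Qy; rewrite !subrr. Qed.

Lemma bimodZ (a : R[i]) x y xi : QM x -> QM y ->
  bimod x (a *: xi) y = a *: bimod x xi y.
Proof.
by move=> Qx Qy; have := bimodDZ a xi 0 Qx Qy; rewrite addr0 bimod0 // addr0.
Qed.

Lemma bimod_sum x y n (F : 'I_n -> LE) : QM x -> QM y ->
  bimod x (\sum_i F i) y = \sum_i bimod x (F i) y.
Proof.
move=> Qx Qy; apply: (big_ind2 (fun a b => bimod x a y = b)) => //.
  exact: bimod0.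
by move=> a b c d <- <-; exact: bimodD.
Qed.

Lemma bimodM x y x' y' xi : QM x -> QM y -> QM x' -> QM y' ->
  bimod x (bimod x' xi y') y = bimod (x \o x') xi (y' \o y).
Proof.
move=> Qx Qy Qx' Qy'; rewrite /bimod -(tensor_oppM Qx Qy) //.
by rewrite (rep_mul (gnsP LE)) //; exact: tensor_opp_alg.
Qed.

Lemma bimod_id xi : bimod id xi id = xi.
Proof. by rewrite /bimod tensor_opp_id (rep_id (gnsP LE)). Qed.

Lemma bimodDZl (a : R[i]) x x' y xi : QM x -> QM x' -> QM y ->
  bimod (a *: x + x') xi y = a *: bimod x xi y + bimod x' xi y.
Proof.
move=> Qx Qx' Qy; rewrite /bimod tensor_oppDZl // (rep_linear (gnsP LE)) //;
  exact: tensor_opp_alg.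
Qed.

Lemma bimodDZr (a : R[i]) x y y' xi : QM x -> QM y -> QM y' ->
  bimod x xi (a *: y + y') = a *: bimod x xi y + bimod x xi y'.
Proof.
move=> Qx Qy Qy'; rewrite /bimod tensor_oppDZr // (rep_linear (gnsP LE)) //;
  exact: tensor_opp_alg.
Qed.

Lemma bimod_adj x y xi eta : QM x -> QM y ->
  ip (bimod x xi y) eta = ip xi (bimod (star x) eta (star y)).
Proof.
move=> Qx Qy; rewrite /bimod lmul_star ?star_tensor_opp //.
exact: tensor_opp_alg.
Qed.

Lemma bimod_bound x y : QM x -> QM y ->
  exists2 C : R[i], 0 <= C & forall xi, `|bimod x xi y| <= C * `|xi|.
Proof. by move=> Qx Qy; apply: lmul_bound; exact: tensor_opp_alg. Qed.

Lemma bimod_one x y : QM x -> QM y ->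
  bimod x (one_tensor_one LE) y = hat LE (tensor_opp x y).
Proof.
move=> Qx Qy; rewrite /bimod /one_tensor_one tensor_opp_id lmul_hat //.
  exact: tensor_opp_alg.
exact: ussa_id.
Qed.

Lemma bimod_ract x y a xi : QM x -> QM y -> QE a ->
  bimod x (ract a xi) y = ract a (bimod x xi y).
Proof. by move=> Qx Qy Qa; rewrite /bimod lmul_ract //; exact: tensor_opp_alg. Qed.

Lemma ract_one a : QE a -> ract a (one_tensor_one LE) = hat LE a.
Proof.
by move=> Qa; rewrite /one_tensor_one tensor_opp_id ract_hat //; exact: ussa_id.
Qed.

End Bimodule.

(** * The subspace L^2(A (x) A^o) and its stability properties *)

Section Subspace.
Variable A : set (M -> M).
Hypotheses (hA : unital_star_subalgebra A) (hAM : A `<=` QM).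
Let AA := alg_tensor_opp (E := E) A.
Let LA := L2_sub LE AA.

Lemma alg_tensor_opp_elt x y : A x -> A y -> AA (tensor_opp x y).
Proof.
move=> Ax Ay; exists 1%N, (fun=> x), (fun=> y); split => //.
by rewrite big_ord1.
Qed.

Lemma alg_tensor_oppD S T : AA S -> AA T -> AA (S + T).
Proof.
move=> [n [x [y [Ax Ay ->]]]] [m [x' [y' [Ax' Ay' ->]]]].
pose glue (f : 'I_n -> M -> M) (g : 'I_m -> M -> M) (i : 'I_(n + m)) :=
  match fintype.split i with inl j => f j | inr j => g j end.
have glueA f g : (forall i, A (f i)) -> (forall i, A (g i)) -> forall i, A (glue f g i).
  by move=> Af Ag i; rewrite /glue; case: fintype.split.
exists (n + m)%N, (glue x x'), (glue y y'); split; try exact: glueA.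
rewrite big_split_ord /=; congr (_ + _); apply: eq_bigr => i _.
  by rewrite /glue (unsplitK (inl i)).
by rewrite /glue (unsplitK (inr i)).
Qed.

Lemma alg_tensor_opp_sub S : AA S -> QE S.
Proof.
move=> [n [x [y [Ax Ay ->]]]]; apply: (ussa_sum hQE) => i.
by apply: tensor_opp_alg; exact: hAM.
Qed.

Lemma alg_tensor_opp_ind (P : (E -> E) -> Prop) :
  (forall x y, A x -> A y -> P (tensor_opp x y)) ->
  (forall S T, AA S -> AA T -> P S -> P T -> P (S + T)) ->
  forall S, AA S -> P S.
Proof.
move=> Pe PD.
(* The empty sum is the elementary tensor 0 (x) 1, so P needs no separate case for zero. *)
have P0 : AA 0 /\ P 0.
  have A0 := ussa0 hA.
  have -> : (0 : E -> E) = tensor_opp 0 id.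
    have := tensor_oppDZl (-1) (hAM A0) (hAM A0) (hAM (ussa_id hA)).
    by rewrite scaleN1r oppr0 addr0 scaleN1r addNr.
  by split; [apply: alg_tensor_opp_elt|apply: Pe] => //; exact: ussa_id.
move=> _ [n [x [y [Ax Ay ->]]]].
suff : AA (\sum_(i < n) tensor_opp (x i) (y i)) /\
  P (\sum_(i < n) tensor_opp (x i) (y i)) by case.
apply: (big_ind (fun S => AA S /\ P S)) => // [S T [AS PS] [AT PT]|i _].
  by split; [exact: alg_tensor_oppD|exact: PD].
by split; [exact: alg_tensor_opp_elt|exact: Pe].
Qed.

Lemma alg_tensor_oppM x y S : A x -> A y -> AA S -> AA (tensor_opp x y \o S).
Proof.
move=> Ax Ay [n [x' [y' [Ax' Ay' ->]]]].
rewrite (ussa_comp_sumr hQE); last by apply: tensor_opp_alg; exact: hAM.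
exists n, (fun i => x \o x' i), (fun i => y' i \o y); split.
- by move=> i; exact: ussa_mul.
- by move=> i; exact: ussa_mul.
- by apply: eq_bigr => i _; rewrite tensor_oppM //; exact: hAM.
Qed.

Lemma alg_tensor_opp_star S : AA S -> AA (star S).
Proof.
apply: (alg_tensor_opp_ind (P := fun S => AA (star S))) => [x y Ax Ay|T U AT AU Ts Us].
  rewrite star_tensor_opp; try exact: hAM.
  by apply: alg_tensor_opp_elt; exact: ussa_starE.
have := starDZ hQE 1 (alg_tensor_opp_sub AT) (alg_tensor_opp_sub AU).
by rewrite rmorph1 !scale1r => ->; exact: alg_tensor_oppD.
Qed.

Lemma alg_tensor_oppZ (c : R[i]) S : AA S -> AA (c *: S).
Proof.
apply: (alg_tensor_opp_ind (P := fun S => AA (c *: S))) => [x y Ax Ay|T U _ _].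
  have -> : c *: tensor_opp x y = tensor_opp (c *: x) y.
    have A0 := ussa0 hA.
    have := tensor_oppDZl (-1) (hAM A0) (hAM A0) (hAM Ay).
    rewrite scaleN1r oppr0 addr0 scaleN1r addNr => t0.
    have := tensor_oppDZl c (hAM Ax) (hAM A0) (hAM Ay).
    by rewrite addr0 t0 addr0.
  by apply: alg_tensor_opp_elt => //; exact: ussa_scale.
by rewrite scalerDr; exact: alg_tensor_oppD.
Qed.

Lemma L2_sub_hat S : AA S -> LA (hat LE S).
Proof. by move=> AS; apply: subset_closure; exists S. Qed.

Lemma L2_sub_one : LA (one_tensor_one LE).
Proof. by apply/L2_sub_hat/alg_tensor_opp_elt; exact: ussa_id. Qed.

Lemma L2_subDZ (c : R[i]) u v : LA u -> LA v -> LA (c *: u + v).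
Proof.
move=> /closure_normP Lu /closure_normP Lv; apply/closure_normP => e e0.
have c1 : 0 < `|c| + 1 by rewrite ltr_wpDl.
have e2 : 0 < e / 2 by rewrite divr_gt0.
have [_ [S AS <-]] := Lu _ (divr_gt0 e2 c1).
rewrite ltr_pdivlMr // => Su.
have [_ [T AT <-] Tv] := Lv _ e2.
exists (hat LE (c *: S + T)).
  by exists (c *: S + T) => //; apply: alg_tensor_oppD => //; exact: alg_tensor_oppZ.
rewrite hatDZ; try exact: alg_tensor_opp_sub.
rewrite opprD addrACA -scalerBr; apply: le_lt_trans (ler_normD _ _) _.
rewrite [e]splitr ltrD // normrZ; apply: le_lt_trans Su.
by rewrite mulrC ler_wpM2l // lerDl.
Qed.

Lemma L2_sub0 : LA 0.
Proof.
by have := @L2_subDZ (-1) _ _ L2_sub_one L2_sub_one; rewrite scaleN1r addNr.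
Qed.

Lemma L2_subD u v : LA u -> LA v -> LA (u + v).
Proof. by move=> Lu Lv; rewrite -[u]scale1r; exact: L2_subDZ. Qed.

Lemma L2_subB u v : LA u -> LA v -> LA (u - v).
Proof. by move=> Lu Lv; rewrite addrC -scaleN1r; exact: L2_subDZ. Qed.

Lemma L2_sub_sum n (F : 'I_n -> LE) : (forall i, LA (F i)) -> LA (\sum_i F i).
Proof. by move=> LF; elim/big_ind: _ => //; [exact: L2_sub0|exact: L2_subD]. Qed.

Lemma L2_sub_closed u :
  (forall e : R[i], 0 < e -> exists2 v, LA v & `|v - u| < e) -> LA u.
Proof.
by move=> /closure_normP; rewrite /LA /L2_sub; apply: closed_closure.
Qed.

Lemma L2_sub_bimod x y u : A x -> A y -> LA u -> LA (bimod x u y).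
Proof.
move=> Ax Ay; have [Qx Qy] := (hAM Ax, hAM Ay).
have [C C0 CP] := bimod_bound Qx Qy.
apply: (closure_image _ C0 CP) => [a b|_ [S AS <-]]; first exact: bimodB.
rewrite /bimod lmul_hat; last exact: alg_tensor_opp_sub.
  exact/L2_sub_hat/alg_tensor_oppM.
exact: tensor_opp_alg.
Qed.

Lemma L2_sub_Jconj u : LA u -> LA (Jconj u).
Proof.
apply: (@closure_image R LE LE (@Jconj R E LE) 1) => // [a b|v|_ [S AS <-]].
- exact: JconjB.
- by rewrite Jconj_norm mul1r.
- rewrite Jconj_hat; last exact: alg_tensor_opp_sub.
  exact/L2_sub_hat/alg_tensor_opp_star.
Qed.

Lemma L2_sub_ract x y u : A x -> A y -> LA u -> LA (ract (tensor_opp x y) u).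
Proof.
move=> Ax Ay Lu; rewrite /ract star_tensor_opp; try exact: hAM.
by apply/L2_sub_Jconj/L2_sub_bimod/L2_sub_Jconj => //; exact: ussa_starE.
Qed.

End Subspace.

Lemma L2_subS A B : B `<=` A ->
  L2_sub LE (alg_tensor_opp (E := E) B) `<=` L2_sub LE (alg_tensor_opp (E := E) A).
Proof.
move=> BA; apply: closure_subset => _ [_ [n [x [y [Bx By ->]]]] <-].
exists (\sum_(i < n) tensor_opp (x i) (y i)) => //.
by exists n, x, y; split => // i; exact: BA.
Qed.

End Tensor.

(** * Right-linear maps, traces and dimensions *)

Section RightModules.
Context {R : realType} {M : tracialVN R} {Mo : opposite M}
  {E : vN_tensor M Mo} (LE : gns E).
Variable A : set (M -> M).
Hypotheses (hA : unital_star_subalgebra A) (hAM : A `<=` vN_alg M).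
Notation tensor_opp := (@tensor_opp R M Mo E).
Notation one := (one_tensor_one LE).
Let AA := alg_tensor_opp (E := E) A.
Let LA := L2_sub LE AA.
Let hL := hilbert_form LE.

Let tE x y : A x -> A y -> vN_alg E (tensor_opp x y).
Proof. by move=> Ax Ay; apply: tensor_opp_alg; exact: hAM. Qed.

Definition rmod n (u : 'I_n -> LE) x y : 'I_n -> LE :=
  fun i => ract (tensor_opp x y) (u i).

(** One coordinate of a bounded right-linear operator. The domain is the full power of L^2(M (x)
    M^o), where [proj] and [Tr_tau] live; the last field ties the map to L^2(A (x) A^o). No adjoint
    is demanded, which keeps the evaluation maps of derivations within the class. *)
Record right_lin n (K : ('I_n -> LE) -> LE) : Prop := RightLin {
  right_lin_linear : forall (c : R[i]) u v, K (c *: u + v) = c *: K u + K v;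
  right_lin_bound : exists2 C : R[i], 0 <= C & forall u, `|K u| <= C * \sum_i `|u i|;
  right_lin_right : forall x y u, A x -> A y ->
    K (rmod u x y) = ract (tensor_opp x y) (K u);
  right_lin_LA : forall u, (forall i, LA (u i)) -> LA (K u)
}.

Lemma right_lin_coord n (i : 'I_n) : right_lin (fun u => u i).
Proof.
split => //; exists 1 => // u.
by rewrite mul1r (bigD1 i) //= lerDl sumr_ge0.
Qed.

Lemma right_linD n (K : ('I_n -> LE) -> LE) u v : right_lin K -> K (u + v) = K u + K v.
Proof. by move=> gK; have := right_lin_linear gK 1 u v; rewrite !scale1r. Qed.

Lemma right_lin0 n (K : ('I_n -> LE) -> LE) : right_lin K -> K 0 = 0.
Proof.
by move=> gK; apply: (addrI (K 0)); rewrite -right_linD // !addr0.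
Qed.

Lemma right_linB n (K : ('I_n -> LE) -> LE) u v : right_lin K -> K (u - v) = K u - K v.
Proof. by move=> gK; rewrite addrC -scaleN1r right_lin_linear // scaleN1r addrC. Qed.

Lemma right_lin_bimod n x y (K : ('I_n -> LE) -> LE) : A x -> A y -> right_lin K ->
  right_lin (fun u => bimod x (K u) y).
Proof.
move=> Ax Ay gK; have [Qx Qy] := (hAM Ax, hAM Ay); split.
- by move=> c u v; rewrite right_lin_linear // bimodDZ.
- have [C C0 CP] := right_lin_bound gK.
  have [C' C'0 C'P] := bimod_bound LE Qx Qy.
  exists (C' * C) => [|u]; first exact: mulr_ge0.
  by apply: le_trans (C'P _) _; rewrite -mulrA ler_wpM2l.
- by move=> x' y' u Ax' Ay'; rewrite right_lin_right // bimod_ract //; exact: tE.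
- by move=> u Lu; apply: L2_sub_bimod => //; exact: right_lin_LA gK _ _.
Qed.

Lemma right_lin_DZ n (c : R[i]) (K K' : ('I_n -> LE) -> LE) : right_lin K -> right_lin K' ->
  right_lin (fun u => c *: K u + K' u).
Proof.
move=> gK gK'; split.
- move=> d u v; rewrite !right_lin_linear // !scalerDr !scalerA mulrC.
  by rewrite addrACA.
- have [C C0 CP] := right_lin_bound gK; have [C' C'0 C'P] := right_lin_bound gK'.
  exists (`|c| * C + C') => [|u]; first by rewrite addr_ge0 ?mulr_ge0.
  apply: le_trans (ler_normD _ _) _; rewrite mulrDl lerD //.
  by rewrite normrZ -mulrA ler_wpM2l.
- by move=> x y u Ax Ay; rewrite !right_lin_right // ractDZ //; exact: tE.
- by move=> u Lu; apply: L2_subDZ => //; [exact: right_lin_LA gK _ _|exact: right_lin_LA gK' _ _].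
Qed.

Lemma right_lin_zero n : right_lin (fun _ : 'I_n -> LE => 0).
Proof.
split=> [c u v|||]; rewrite ?scaler0 ?addr0 //.
- by exists 0 => // u; rewrite normr0 mul0r.
- move=> x y u Ax Ay; have t := tE Ax Ay.
  by have := ractB (0 : LE) 0 t; rewrite !subrr.
- by move=> u _; exact: L2_sub0.
Qed.

Lemma right_lin_add n (K K' : ('I_n -> LE) -> LE) : right_lin K -> right_lin K' ->
  right_lin (fun u => K u + K' u).
Proof.
move=> gK gK'; have := right_lin_DZ 1 gK gK'.
by under [X in right_lin X]funext do rewrite scale1r.
Qed.

Lemma right_lin_sub n (K K' : ('I_n -> LE) -> LE) : right_lin K -> right_lin K' ->
  right_lin (fun u => K u - K' u).
Proof.
move=> gK gK'; have := right_lin_DZ (-1) gK' gK.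
by under [X in right_lin X]funext do rewrite scaleN1r addrC.
Qed.

Lemma right_lin_sum n m (K : 'I_m -> ('I_n -> LE) -> LE) : (forall j, right_lin (K j)) ->
  right_lin (fun u => \sum_j K j u).
Proof.
elim: m K => [|m IH] K gK.
  under [X in right_lin X]funext do rewrite big_ord0.
  exact: right_lin_zero.
under [X in right_lin X]funext do rewrite big_ord_recl.
by apply: right_lin_add => //; exact: IH.
Qed.

Lemma right_lin_comp n m (K : ('I_m -> LE) -> LE) (T : 'I_m -> ('I_n -> LE) -> LE) :
  right_lin K -> (forall j, right_lin (T j)) -> right_lin (fun u => K (fun j => T j u)).
Proof.
move=> gK gT; split.
- move=> c u v; rewrite -(right_lin_linear gK); congr K; apply/funext => j.
  exact: right_lin_linear.
- have [C C0 CP] := right_lin_bound gK.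
  have /choice[C' C'P] j : exists C', 0 <= C' /\ forall u, `|T j u| <= C' * \sum_i `|u i|.
    by have [C' ? ?] := right_lin_bound (gT j); exists C'.
  exists (C * \sum_j C' j) => [|u].
    by rewrite mulr_ge0 // sumr_ge0 // => j _; have [] := C'P j.
  apply: le_trans (CP _) _; rewrite -mulrA ler_wpM2l // mulr_suml.
  by apply: ler_sum => j _; have [_] := C'P j; exact.
- move=> x y u Ax Ay; rewrite -right_lin_right //; congr K; apply/funext => j.
  by rewrite right_lin_right.
- by move=> u Lu; apply: (right_lin_LA gK) => j; exact: right_lin_LA.
Qed.

Record right_submodule n (V : set ('I_n -> LE)) : Prop := RightSubmodule {
  rsub_closed : closed_subspace V;
  rsub_L2 : forall u i, V u -> LA (u i);
  rsub_right : forall x y u, A x -> A y -> V u -> V (rmod u x y)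
}.

Lemma ipn_rmod n (u v : 'I_n -> LE) x y : A x -> A y ->
  ipn (rmod u x y) v = ipn u (rmod v (star x) (star y)).
Proof.
move=> Ax Ay; apply: eq_bigr => i _; rewrite ract_adj; last exact: tE.
by rewrite star_tensor_opp //; exact: hAM.
Qed.

(** The right action of x (x) y has adjoint x^* (x) y^*, which preserves V too; hence it preserves
    the orthogonal complement and commutes with the projection. *)
Lemma right_lin_proj n (V : set ('I_n -> LE)) i : right_submodule V ->
  right_lin (fun u => Defs.proj V u i).
Proof.
move=> [Vc VL Vr]; split.
- by move=> c u v; rewrite proj_linear.
- exists 1 => // u; rewrite mul1r.
  apply: le_trans (normn_coord _ _) _.
  exact: le_trans (normn_proj Vc _) (normn_sum _).
- move=> x y u Ax Ay; have [Vu uP] := projP Vc u.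
  rewrite (@proj_uniq _ _ _ _ Vc _ (rmod (Defs.proj V u) x y)) //.
    exact: Vr.
  move=> v Vv.
  have -> : rmod u x y - rmod (Defs.proj V u) x y = rmod (u - Defs.proj V u) x y.
    by apply/funext => j; rewrite /rmod /= [RHS]ractB //; exact: tE.
  by rewrite ipn_rmod // uP //; apply: Vr => //; exact: ussa_starE.
- by move=> u _; apply: VL; have [] := projP Vc u.
Qed.

(** For a = [one] these are the test vectors in [Tr_tau]. *)
Definition slot n (i : 'I_n) (a : LE) : 'I_n -> LE := fun j => if j == i then a else 0.

Lemma slotD n (i : 'I_n) a b : slot i (a + b) = slot i a + slot i b.
Proof.
apply/funext => j; rewrite /slot [RHS]/GRing.add /=.
by case: ifP; rewrite ?addr0.
Qed.

Lemma slotB n (i : 'I_n) a b : slot i (a - b) = slot i a - slot i b.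
Proof.
apply/funext => j; rewrite /slot [RHS]/GRing.add /= [in RHS]/GRing.opp /=.
by case: ifP; rewrite ?subr0.
Qed.

Lemma slot_sum n (u : 'I_n -> LE) : u = \sum_i slot i (u i).
Proof.
apply/funext => j; rewrite fct_sumE (bigD1 j) //= {1}/slot eqxx big1 ?addr0 //.
by move=> i ij; rewrite /slot eq_sym (negbTE ij).
Qed.

Lemma right_lin_slot_sum n (K : ('I_n -> LE) -> LE) u : right_lin K ->
  K u = \sum_i K (slot i (u i)).
Proof.
move=> gK; rewrite {1}[u]slot_sum.
apply: (big_ind2 (fun a b => K a = b)) => //; first exact: right_lin0.
by move=> a b c d <- <-; exact: right_linD.
Qed.

(* A right-linear map is determined on the [i]th slot by its value at [1 (x) 1],
   which gives its trace pairing without any adjoint. *)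
Lemma right_lin_slot_ip n (K : ('I_n -> LE) -> LE) i a : right_lin K -> LA a ->
  ip (K (slot i a)) one = ip (K (slot i one)) (Jconj a).
Proof.
move=> gK La; have [C C0 CP] := right_lin_bound gK.
have slot_le c : `|K (slot i c)| <= C * `|c|.
  apply: le_trans (CP _) _; rewrite ler_wpM2l // (bigD1 i) //= big1.
    by rewrite addr0 /slot eqxx.
  by move=> j ji; rewrite /slot (negbTE ji) normr0.
apply/eqP; rewrite -subr_eq0; apply/eqP.
apply: (@dense_eq0 R LE R[i]^o (fun a => ip (K (slot i a)) one -
   ip (K (slot i one)) (Jconj a)) (C * `|one| + `|K (slot i one)|)
   [set hat LE S | S in AA]) => //.
- move=> b c; rewrite slotB right_linB // JconjB (formBl hL) (formBr hL).
  by rewrite !opprD !opprK addrACA.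
- by rewrite addr_ge0 ?mulr_ge0.
- move=> b; apply: le_trans (ler_normB _ _) _; rewrite mulrDl lerD //.
    apply: le_trans (ip_le _ _) _; rewrite mulrAC ler_wpM2r //.
  by apply: le_trans (ip_le _ _) _; rewrite Jconj_norm.
move=> _ [S AS <-]; apply/eqP; rewrite subr_eq0; apply/eqP.
move: S AS; apply: (alg_tensor_opp_ind hA hAM) => [x y Ax Ay|S T AS AT hS hT].
  have t := tE Ax Ay; rewrite -(ract_one LE t).
  have -> : slot i (ract (tensor_opp x y) one) = rmod (slot i one) x y.
    apply/funext => j; rewrite /slot /rmod; case: ifP => // _.
    by have := ractB (0 : LE) 0 t; rewrite !subrr.
  have t' := ussa_starE (vN_ussa E) t.
  by rewrite right_lin_right // ract_adj // !ract_one // Jconj_hat.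
rewrite hatD ?slotD ?right_linD ?JconjD //; try exact: (alg_tensor_opp_sub hAM).
by rewrite (formDl hL) (formDr hL) hS hT.
Qed.

Lemma trace_pairing n m (S : 'I_n -> ('I_m -> LE) -> LE)
    (T : 'I_m -> ('I_n -> LE) -> LE) :
  (forall i, right_lin (S i)) -> (forall j, right_lin (T j)) ->
  \sum_i ip (S i (fun j => T j (slot i one))) one =
  \sum_i \sum_j ip (S i (slot j one)) (Jconj (T j (slot i one))).
Proof.
move=> gS gT; apply: eq_bigr => i _; rewrite (right_lin_slot_sum _ (gS i)).
rewrite (big_morph (fun x => ip x one) (fun x y => formDl hL x y one) (form0l hL _)).
apply: eq_bigr => j _; apply: right_lin_slot_ip => //.
apply: (right_lin_LA (gT j)) => k; rewrite /slot; case: ifP => _.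
  exact: L2_sub_one.
exact: L2_sub0.
Qed.

Lemma ip_Jconj_sym (u v : LE) : ip u (Jconj v) = ip v (Jconj u).
Proof. by rewrite -{1}(JconjK u) Jconj_ip. Qed.

Lemma trace_comm n m (S : 'I_n -> ('I_m -> LE) -> LE)
    (T : 'I_m -> ('I_n -> LE) -> LE) :
  (forall i, right_lin (S i)) -> (forall j, right_lin (T j)) ->
  \sum_i ip (S i (fun j => T j (slot i one))) one =
  \sum_j ip (T j (fun i => S i (slot j one))) one.
Proof.
move=> gS gT; rewrite (trace_pairing gS gT) (trace_pairing gT gS) exchange_big.
by apply: eq_bigr => j _; apply: eq_bigr => i _; exact: ip_Jconj_sym.
Qed.

(* [V] is the direct sum of the copies [S1 W1] and [S2 W2]; the trace of the
   idempotent [S1 T1] on [V] is that of [T1 S1], the identity of [W1]. *)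
Lemma vN_dim_split n m1 m2 (V : set ('I_n -> LE)) (W1 : set ('I_m1 -> LE))
    (W2 : set ('I_m2 -> LE))
    (T1 : 'I_m1 -> ('I_n -> LE) -> LE) (S1 : 'I_n -> ('I_m1 -> LE) -> LE)
    (T2 : 'I_m2 -> ('I_n -> LE) -> LE) (S2 : 'I_n -> ('I_m2 -> LE) -> LE) :
  right_submodule V -> right_submodule W1 -> right_submodule W2 ->
  (forall j, right_lin (T1 j)) -> (forall j, right_lin (S1 j)) ->
  (forall j, right_lin (T2 j)) -> (forall j, right_lin (S2 j)) ->
  (forall u, V u -> W1 (T1^~ u)) -> (forall w, W1 w -> V (S1^~ w)) ->
  (forall u, V u -> W2 (T2^~ u)) -> (forall w, W2 w -> V (S2^~ w)) ->
  (forall w, W1 w -> T1^~ (S1^~ w) = w) -> (forall w, W2 w -> T2^~ (S2^~ w) = w) ->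
  (forall u i, V u -> S1 i (T1^~ u) + S2 i (T2^~ u) = u i) ->
  vN_dim one V = vN_dim one W1 + vN_dim one W2.
Proof.
move=> hV hW1 hW2 gT1 gS1 gT2 gS2 VT1 WS1 VT2 WS2 TS1 TS2 ST.
have pV u : V (Defs.proj V u) by have [] := projP (rsub_closed hV) u.
have part m (W : set ('I_m -> LE)) (T : 'I_m -> ('I_n -> LE) -> LE)
    (S : 'I_n -> ('I_m -> LE) -> LE) :
    right_submodule W -> (forall j, right_lin (T j)) -> (forall j, right_lin (S j)) ->
    (forall u, V u -> W (T^~ u)) -> (forall w, W w -> V (S^~ w)) ->
    (forall w, W w -> T^~ (S^~ w) = w) ->
    \sum_i ip (S i (T^~ (Defs.proj V (slot i one)))) one =
    Tr_tau one (Defs.proj W).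
  move=> hW gT gS VT WS TS.
  have pW u : W (Defs.proj W u) by have [] := projP (rsub_closed hW) u.
  transitivity (\sum_i ip (S i (Defs.proj W (T^~ (Defs.proj V (slot i one))))) one).
    by apply: eq_bigr => i _; rewrite (proj_id (rsub_closed hW)) //; exact: VT.
  (* T S is the identity only on W, and S T enters only through V. Absorbing the projections into S'
     and T' makes the maps global, so cyclicity applies and leaves T proj_V S proj_W = proj_W. *)
  pose S' i u := S i (Defs.proj W u).
  pose T' j u := T j (Defs.proj V u).
  have gS' i : right_lin (S' i).
    by apply: (right_lin_comp (T := fun j u => Defs.proj W u j)) => // j; exact: right_lin_proj.
  have gT' j : right_lin (T' j).
    by apply: (right_lin_comp (T := fun j u => Defs.proj V u j)) => // i; exact: right_lin_proj.
  rewrite (trace_comm gS' gT'); apply: eq_bigr => j _.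
  rewrite /T' /S' (proj_id (rsub_closed hV)); last exact: WS.
  by have := congr1 (fun f => f j) (TS _ (pW (slot j one))) => /= ->.
rewrite /vN_dim -(part _ _ _ _ hW1 gT1 gS1) // -(part _ _ _ _ hW2 gT2 gS2) //.
rewrite -raddfD; congr complex.Re; rewrite -big_split /=.
by apply: eq_bigr => i _; rewrite -(formDl hL) ST.
Qed.

End RightModules.

(** * Derivations *)

Section Derivations.
Context {R : realType} {M : tracialVN R} {Mo : opposite M}
  {E : vN_tensor M Mo} (LM : gns M) (LE : gns E).
Variable A : set (M -> M).
Hypotheses (hA : unital_star_subalgebra A) (hAM : A `<=` vN_alg M).
Notation tensor_opp := (@tensor_opp R M Mo E).
Notation one := (one_tensor_one LE).
Let LA := L2_sub LE (alg_tensor_opp (E := E) A).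
Let hL := hilbert_form LE.
Let hQM := vN_ussa M.
Let A1 : A id := ussa_id hA.
Let Q1 : vN_alg M id := ussa_id hQM.
Implicit Types (x y p q : M -> M) (d : (M -> M) -> LE) (xi eta : LE).

Definition inner xi : (M -> M) -> LE := fun x => bimod x xi id - bimod id xi x.

Lemma inner_derivation xi : LA xi -> derivation A (inner xi).
Proof.
move=> Lxi; split=> [x Ax|a x y Ax Ay|x y Ax Ay].
- by apply: L2_subB => //; apply: L2_sub_bimod.
- have [Qx Qy] := (hAM Ax, hAM Ay).
  rewrite /inner bimodDZl // bimodDZr // scalerBr opprD addrACA //.
- have [Qx Qy] := (hAM Ax, hAM Ay).
  rewrite /inner !bimodB // !bimodM //.
  by rewrite [RHS]addrA subrK.
Qed.

Lemma derivation_DZ (c : R[i]) d d' :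
  derivation A d -> derivation A d' -> derivation A (c *: d + d').
Proof.
move=> [dL dl dm] [dL' dl' dm'].
have cd x : (c *: d + d') x = c *: d x + d' x by [].
split=> [x Ax|a x y Ax Ay|x y Ax Ay]; rewrite !cd.
- by apply: L2_subDZ => //; [exact: dL|exact: dL'].
- by rewrite dl // dl' // !scalerDr !scalerA mulrC addrACA.
- have [Qx Qy] := (hAM Ax, hAM Ay).
  by rewrite dm // dm' // !bimodDZ // scalerDr addrACA.
Qed.

(** By Riesz, membership in the domain of the adjoint becomes an estimate in trace norm, and the
    representing vector is automatically in L^2(A). *)
Lemma in_dom_adjointP d eta : derivation A d ->
  (exists C : R[i], forall x, A x -> `|ip (d x) eta| <= C * `|hat LM x|) <->
  in_dom_adjoint LM A d eta.
Proof.
move=> [_ dl _]; split=> [[C CP]|[zeta _ zP]]; last first.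
  by exists `|zeta| => x Ax; rewrite zP // mulrC; exact: ip_le.
have [|||||z zA zP] := riesz_dense (D := A) (g := hat LM)
  (F := fun x => ip (d x) eta) (K := C) (hilbert_form LM) (hilbert_cauchy (H := LM)).
- by exists id.
- by move=> *; exact: ussa_lin.
- by move=> a x y Ax Ay; rewrite hatDZ //; exact: hAM.
- by move=> a x y Ax Ay; rewrite dl // (form_lin hL).
- by move=> x Ax; rewrite hilbert_norm; exact: CP.
exists z => //; apply/closure_normP => e /zA[i Ai iz].
by exists (hat LM i); [exists i|rewrite -hilbert_norm].
Qed.

(** Moving x and y across the inner product leaves the vector x^* (x) y^*, whose norm is a product
    of trace norms; operator norms never enter. *)
Lemma bimod_one_le x y xi : vN_alg M x -> vN_alg M y ->
  `|ip (bimod x xi y) one| <= `|xi| * (`|hat LM x| * `|hat LM y|).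
Proof.
move=> Qx Qy; have [Qx' Qy'] := (ussa_starE hQM Qx, ussa_starE hQM Qy).
rewrite bimod_adj // bimod_one //.
apply: le_trans (ip_le _ _) _; rewrite (hat_tensor_opp_norm LM) //.
by rewrite !hat_star_norm.
Qed.

(* [<x xi - xi x, 1 (x) 1> = <xi, x^* (x) 1 - 1 (x) x^*>] and
   [x |-> x (x) 1] is isometric, so no regularity of [xi] is needed. *)
Lemma inner_in_dom xi : LA xi -> in_dom_adjoint LM A (inner xi) one.
Proof.
move=> Lxi; apply/in_dom_adjointP; first exact: inner_derivation.
exists (`|xi| + `|xi|) => x Ax; rewrite /inner (formBl hL).
apply: le_trans (ler_normB _ _) _; rewrite mulrDl.
have Qx := hAM Ax.
apply: lerD; apply: le_trans (bimod_one_le _ _ _) _ => //.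
  by rewrite hat_id_norm mulr1.
by rewrite hat_id_norm mul1r.
Qed.

Lemma in_dom_DZ (c : R[i]) d d' : derivation A d -> derivation A d' ->
  in_dom_adjoint LM A d one -> in_dom_adjoint LM A d' one ->
  in_dom_adjoint LM A (c *: d + d') one.
Proof.
move=> dA dA' /(in_dom_adjointP _ dA)[C CP] /(in_dom_adjointP _ dA')[C' C'P].
apply/in_dom_adjointP; first exact: derivation_DZ.
exists (`|c| * C + C') => x Ax.
have -> : (c *: d + d') x = c *: d x + d' x by [].
rewrite (form_lin hL); apply: le_trans (ler_normD _ _) _; rewrite mulrDl.
rewrite lerD //; last exact: C'P.
by rewrite normrM -mulrA ler_wpM2l // CP.
Qed.

Definition der_ract d p q : (M -> M) -> LE := fun x => ract (tensor_opp p q) (d x).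

Lemma derivation_ract d p q : A p -> A q -> derivation A d ->
  derivation A (der_ract d p q).
Proof.
move=> Ap Aq [dL dl dm]; have [Qp Qq] := (hAM Ap, hAM Aq).
have t : vN_alg E (tensor_opp p q) by exact: tensor_opp_alg.
split=> [x Ax|a x y Ax Ay|x y Ax Ay]; rewrite /der_ract.
- by apply: L2_sub_ract => //; exact: dL.
- by rewrite dl // ractDZ.
- have [Qx Qy] := (hAM Ax, hAM Ay).
  rewrite dm // !bimod_ract //.
  by rewrite -[bimod x _ id]scale1r ractDZ // !scale1r.
Qed.

Lemma hat_mull_bound p : vN_alg M p ->
  exists2 C : R[i], 0 <= C & forall x, vN_alg M x -> `|hat LM (p \o x)| <= C * `|hat LM x|.
Proof.
move=> Qp; have [C C0 CP] := lmul_bound LM Qp; exists C => // x Qx.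
by rewrite -lmul_hat.
Qed.

Lemma hat_mulr_bound q : vN_alg M q ->
  exists2 C : R[i], 0 <= C & forall x, vN_alg M x -> `|hat LM (x \o q)| <= C * `|hat LM x|.
Proof.
move=> Qq; have [C C0 CP] := hat_mull_bound (ussa_starE hQM Qq); exists C => // x Qx.
rewrite -(hat_star_norm LM (ussa_mul hQM Qx Qq)) (starM hQM) //.
by rewrite -(hat_star_norm LM Qx); apply: CP; exact: ussa_starE.
Qed.

(** Left and right multiplication agree on the trace vector, so pairing the right translate of d x
    with 1 (x) 1 gives <p d(x) q, 1 (x) 1>. By Leibniz p d(x) q = d(p x q) - d(p) x q - p x d(q);
    the first term is bounded by hypothesis and the others by [bimod_one_le]. *)
Lemma in_dom_ract d p q : A p -> A q -> derivation A d ->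
  in_dom_adjoint LM A d one -> in_dom_adjoint LM A (der_ract d p q) one.
Proof.
move=> Ap Aq dA /(in_dom_adjointP _ dA)[C CP].
apply/in_dom_adjointP; first exact: derivation_ract.
have [Qp Qq] := (hAM Ap, hAM Aq).
have [Cp Cp0 CpP] := hat_mull_bound Qp.
have [Cq Cq0 CqP] := hat_mulr_bound Qq.
exists (`|C| * Cp * Cq + `|d p| * Cq + `|d q| * Cp) => x Ax.
have Qx := hAM Ax.
have Apx : A (p \o x) by exact: ussa_mul.
have Axq : A (x \o q) by exact: ussa_mul.
have Apxq : A (p \o (x \o q)) by exact: ussa_mul.
have [Qpx Qxq] := (hAM Apx, hAM Axq).
have -> : ip (der_ract d p q x) one = ip (d (p \o (x \o q))) one -
    ip (bimod id (d p) (x \o q)) one - ip (bimod (p \o x) (d q) id) one.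
  have [Qp' Qq'] := (ussa_starE hQM Qp, ussa_starE hQM Qq).
  have t : vN_alg E (tensor_opp p q) by exact: tensor_opp_alg.
  rewrite /der_ract ract_adj // ract_one; last exact: (ussa_starE (vN_ussa E)).
  rewrite star_tensor_opp // -bimod_one //.
  have -> : ip (d x) (bimod (star p) one (star q)) = ip (bimod p (d x) q) one.
    by rewrite bimod_adj.
  rewrite -!(formBl hL); congr ip.
  rewrite (der_leibniz dA) // (der_leibniz dA) // bimodD // !bimodM //.
  by rewrite addrK [X in X - _]addrC addrK.
rewrite !mulrDl.
apply: le_trans (ler_normB _ _) _; apply: lerD; last first.
  apply: le_trans (bimod_one_le _ _ _) _ => //.
  by rewrite hat_id_norm mulr1 -mulrA ler_wpM2l // CpP.
apply: le_trans (ler_normB _ _) _; apply: lerD; last first.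
  apply: le_trans (bimod_one_le _ _ _) _ => //.
  by rewrite hat_id_norm mul1r -mulrA ler_wpM2l // CqP.
apply: le_trans (_ : `|C| * `|hat LM (p \o (x \o q))| <= _).
  apply: le_trans (CP _ Apxq) _.
  have [->|h0] := eqVneq (hat LM (p \o (x \o q))) 0; first by rewrite normr0 !mulr0.
  rewrite ler_pM2r ?normr_gt0 //; apply: real_ler_norm.
  have : 0 <= C * `|hat LM (p \o (x \o q))| by apply: le_trans (CP _ Apxq).
  by rewrite pmulr_lge0 ?normr_gt0 // => /ger0_real.
rewrite -!mulrA ler_wpM2l //; apply: le_trans (CpP _ Qxq) _.
by rewrite ler_wpM2l // CqP.
Qed.

(** * Values of a derivation as functions of its values on generators *)

Section Generators.
Variables (B A0 : set (M -> M)) (n : nat) (X : 'I_n -> M -> M).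
Hypotheses (hB : unital_star_subalgebra B) (hA0 : unital_star_subalgebra A0).
Hypotheses (A0A : A0 `<=` A) (hX : generating_set B A0 X).

(* No constraint on the values, unlike [derivation]: on [A0 = B] they lie in
   [L^2(A (x) A^o)]. *)
Definition rel_derivation d : Prop :=
  [/\ forall (a : R[i]) x y, A0 x -> A0 y -> d (a *: x + y) = a *: d x + d y,
      forall x y, A0 x -> A0 y -> d (x \o y) = bimod x (d y) id + bimod id (d x) y &
      forall b, B b -> d b = 0].

Lemma rel_derivation0 d : rel_derivation d -> d 0 = 0.
Proof.
move=> [dl _ _]; have A00 := ussa0 hA0.
by have := dl (-1) _ _ A00 A00; rewrite scaler0 addr0 scaleN1r addNr.
Qed.

Lemma generating_sub : B `<=` A0.
Proof.
case: hX => _ _ ->; apply: sub_smallest; exact: subsetUl.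
Qed.

Lemma generating_mem i : A0 (X i).
Proof.
case: hX => _ _ ->; apply: (@sub_smallest _ _ (B `|` range X) (range X)).
  exact: subsetUr.
by exists i.
Qed.

Let evals x K := right_lin A K /\ forall d, rel_derivation d -> d x = K (phi X d).

(** K depends on x but not on d. This single fact gives continuity of evaluation, closedness of the
    range of [phi] and the matrix form of all later maps. It is proved by showing that the elements
    x with such a K form a unital *-subalgebra containing B and X. *)
Lemma derivation_eval x : A0 x -> exists K, right_lin A K /\
  forall d, rel_derivation d -> d x = K (phi X d).
Proof.
have BA := generating_sub.
have XA := generating_mem.
(* Derivations need not respect adjoints, so d(x^* ) is not determined by d(x) alone; closure under
   the star is obtained by carrying an evaluation for both. *)
suff /(_ x) : A0 `<=` [set x | A0 x /\ exists K K', evals x K /\ evals (star x) K'].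
  by move=> h /h[_ [K [_ [KP _]]]]; exists K.
case: (hX) => _ Xs {1}->; apply: smallest_sub; last first.
  move=> y [By|[i _ <-]]; split.
  - exact: BA.
  - exists (fun=> 0), (fun=> 0); split; split; try exact: right_lin_zero.
      by move=> d [_ _]; apply.
    by move=> d [_ _]; apply; exact: ussa_starE.
  - exact: XA.
  - have [j ij] := Xs i; rewrite (star_eq ij).
    by exists (fun u => u i), (fun u => u j); split; split => //; exact: right_lin_coord.
split.
- by move=> y [Ay _]; exact: (ussa_bounded hA0).
- split; [exact: (ussa_id hA0)|exists (fun=> 0), (fun=> 0)].
  have -> : star (id : M -> M) = id by exact: star_eq.
  by split; split; try exact: right_lin_zero; move=> d [_ _]; apply; exact: ussa_id.
- move=> y z [Ay [K [K' [[gK KP] [gK' K'P]]]]] [Az [H [H' [[gH HP] [gH' H'P]]]]].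
  split; first exact: ussa_add.
  exists (fun u => K u + H u), (fun u => K' u + H' u).
  split; split; try exact: right_lin_add.
    move=> d dD; rewrite -KP // -HP //; case: dD => dl _ _.
    by have := dl 1 _ _ Ay Az; rewrite !scale1r.
  move=> d dD; rewrite -K'P // -H'P //; case: dD => dl _ _.
  have := starDZ hA0 1 Ay Az; rewrite rmorph1 !scale1r => ->.
  by have := dl 1 _ _ (ussa_starE hA0 Ay) (ussa_starE hA0 Az); rewrite !scale1r.
- move=> a y [Ay [K [K' [[gK KP] [gK' K'P]]]]].
  split; first exact: ussa_scale.
  exists (fun u => a *: K u + 0), (fun u => a^* *: K' u + 0).
  split; split; try by apply: right_lin_DZ => //; exact: right_lin_zero.
    move=> d dD; rewrite -KP // -(rel_derivation0 dD); case: dD => dl _ _.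
    by rewrite -dl ?addr0 //; exact: ussa0.
  move=> d dD; rewrite -K'P // -(rel_derivation0 dD); case: dD => dl _ _.
  rewrite -dl ?addr0; [|exact: ussa_starE|exact: ussa0].
  have := starDZ hA0 a Ay (ussa0 hA0).
  have -> : star (0 : M -> M) = 0.
    by apply: star_eq => u v; rewrite (form0l (hilbert_form M)) (form0r (hilbert_form M)).
  by rewrite !addr0 => ->.
- move=> y z [Ay [K [K' [[gK KP] [gK' K'P]]]]] [Az [H [H' [[gH HP] [gH' H'P]]]]].
  split; first exact: ussa_mul.
  have [Ay' Az'] := (ussa_starE hA0 Ay, ussa_starE hA0 Az).
  exists (fun u => bimod y (H u) id + bimod id (K u) z).
  exists (fun u => bimod (star z) (K' u) id + bimod id (H' u) (star y)).
  split; split; try by apply: right_lin_add => //; apply: right_lin_bimod => //; exact: A0A.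
    by move=> d dD; rewrite -KP // -HP //; case: dD => _ dm _; exact: dm.
  move=> d dD; rewrite -K'P // -H'P // (starM hA0) //; case: dD => _ dm _.
  exact: dm.
- move=> y [Ay [K [K' [KP K'P]]]]; exists (star y); last exact: star_adj hA0 _ Ay.
  split; first exact: ussa_starE.
  by exists K', K; rewrite (starK hA0).
Qed.

End Generators.

Section Vanishing.
Variable B : set (M -> M).

Lemma Der_rel d : Der B A d -> rel_derivation B A d.
Proof. by move=> [[_ dl dm] dB]. Qed.

Lemma Der_DZ (c : R[i]) d d' : Der B A d -> Der B A d' -> Der B A (c *: d + d').
Proof.
move=> [dA dB] [dA' dB']; split; first exact: derivation_DZ.
move=> b Bb; have -> : (c *: d + d') b = c *: d b + d' b by [].
by rewrite dB // dB' // scaler0 addr0.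
Qed.

Lemma Der11_DZ (c : R[i]) d d' :
  Der11 LM B A d -> Der11 LM B A d' -> Der11 LM B A (c *: d + d').
Proof.
move=> [dA dd] [dA' dd']; split; first exact: Der_DZ.
by apply: in_dom_DZ dd dd'; [case: dA|case: dA'].
Qed.

Lemma Der_ract d p q : A p -> A q -> Der B A d -> Der B A (der_ract d p q).
Proof.
move=> Ap Aq [dA dB]; split; first exact: derivation_ract.
move=> b Bb; rewrite /der_ract dB //.
have t : vN_alg E (tensor_opp p q) by apply: tensor_opp_alg; exact: hAM.
by have := ractB (0 : LE) 0 t; rewrite !subrr.
Qed.

Lemma Der11_ract d p q : A p -> A q -> Der11 LM B A d -> Der11 LM B A (der_ract d p q).
Proof.
move=> Ap Aq [dA dd]; split; first exact: Der_ract.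
by apply: in_dom_ract dd => //; case: dA.
Qed.

Lemma Der_zero : Der B A (0 : (M -> M) -> LE).
Proof.
split => //; split=> [x Ax|a x y _ _|x y Ax Ay].
- exact: L2_sub0.
- by rewrite scaler0 addr0.
- by rewrite !bimod0 ?addr0 //; exact: hAM.
Qed.

Lemma Der11_zero : Der11 LM B A (0 : (M -> M) -> LE).
Proof.
split; first exact: Der_zero.
apply/in_dom_adjointP; first by have [] := Der_zero.
by exists 0 => x _; rewrite (form0l hL) normr0 mul0r.
Qed.

Section Evaluation.
Variables (n : nat) (X : 'I_n -> M -> M).
Hypotheses (hB : unital_star_subalgebra B) (hX : generating_set B A X).

Lemma right_lin_normn (K : ('I_n -> LE) -> LE) : right_lin A K ->
  exists2 C : R[i], 0 <= C & forall u, `|K u| <= C * normn u.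
Proof.
move=> gK; have [C C0 CP] := right_lin_bound gK.
exists (C * n%:R) => [|u]; first by rewrite mulr_ge0 ?ler0n.
apply: le_trans (CP u) _; rewrite -mulrA ler_wpM2l //.
apply: le_trans (_ : \sum_(i < n) normn u <= _).
  by apply: ler_sum => i _; exact: normn_coord.
by rewrite sumr_const card_ord -[_ *+ n]mulr_natl.
Qed.

Lemma right_lin_vanish (K : ('I_n -> LE) -> LE) (V : set ('I_n -> LE)) u : right_lin A K ->
  (forall v, V v -> K v = 0) ->
  (forall e : R[i], 0 < e -> exists2 v, V v & normn (v - u) < e) -> K u = 0.
Proof.
move=> gK KV uV; have [C C0 CP] := right_lin_normn gK.
apply/eqP; rewrite -normr_eq0; apply/eqP/le_anti; rewrite normr_ge0 andbT.
apply/ler_addgt0Pl => e e0; rewrite addr0.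
have C1 : 0 < C + 1 by rewrite ltr_wpDl.
have [v Vv] := uV _ (divr_gt0 e0 C1); rewrite ltr_pdivlMr // => /ltW h.
apply: le_trans h; rewrite -normrN -[- _]add0r -(KV _ Vv) -(right_linB _ _ gK).
apply: le_trans (CP _) _; rewrite mulrC ler_wpM2l ?lerDl //.
exact: fnorm_ge0 ipn_form _.
Qed.

Notation V := [set phi X d | d in closed_Der11 (LE := LE) LM B A X].

Lemma normn_ract p q : A p -> A q -> exists2 C : R[i], 0 <= C &
  forall u : 'I_n -> LE, normn (rmod u p q) <= C * normn u.
Proof.
move=> Ap Aq; have t : vN_alg E (tensor_opp p q) by apply: tensor_opp_alg; exact: hAM.
have [C C0 CP] := ract_bound LE t.
exists (\sum_(i < n) C) => [|u]; first by rewrite sumr_ge0.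
apply: le_trans (normn_sum _) _; rewrite mulr_suml; apply: ler_sum => i _.
apply: le_trans (CP _) _; rewrite ler_wpM2l //; exact: normn_coord.
Qed.

Lemma closed_Der11_DZ (c : R[i]) d d' : closed_Der11 LM B A X d ->
  closed_Der11 LM B A X d' -> closed_Der11 LM B A X (c *: d + d').
Proof.
move=> [dD dP] [dD' dP']; split; first exact: Der_DZ.
move=> e e0.
have c1 : 0 < `|c| + 1 by rewrite ltr_wpDl.
have e2 : 0 < e / 2 by rewrite divr_gt0.
have [f fD] := dP _ (divr_gt0 e2 c1); rewrite ltr_pdivlMr // => fe.
have [f' fD' fe'] := dP' _ e2.
exists (c *: f + f'); first exact: Der11_DZ.
have -> : phi X (c *: d + d' - (c *: f + f')) = c *: phi X (d - f) + phi X (d' - f').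
  apply/funext => i; rewrite /phi.
  have -> : (c *: d + d' - (c *: f + f')) (X i) =
    c *: d (X i) + d' (X i) - (c *: f (X i) + f' (X i)) by [].
  have -> : (c *: (fun i => (d - f) (X i)) + (fun i => (d' - f') (X i))) i =
    c *: (d (X i) - f (X i)) + (d' (X i) - f' (X i)) by [].
  by rewrite opprD addrACA scalerBr.
apply: le_lt_trans (fnormD ipn_form _ _) _; rewrite [e]splitr ltrD //.
rewrite (fnormZ ipn_form); apply: le_lt_trans fe.
by rewrite mulrC ler_wpM2l ?lerDl // (fnorm_ge0 ipn_form).
Qed.

Lemma closed_Der11_ract d p q : A p -> A q -> closed_Der11 LM B A X d ->
  closed_Der11 LM B A X (der_ract d p q).
Proof.
move=> Ap Aq [dD dP]; split; first exact: Der_ract.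
move=> e e0; have [C C0 CP] := normn_ract Ap Aq.
have C1 : 0 < C + 1 by rewrite ltr_wpDl.
have [f fD] := dP _ (divr_gt0 e0 C1); rewrite ltr_pdivlMr // => fe.
exists (der_ract f p q); first exact: Der11_ract.
have t : vN_alg E (tensor_opp p q) by apply: tensor_opp_alg; exact: hAM.
have -> : phi X (der_ract d p q - der_ract f p q) = rmod (phi X (d - f)) p q.
  by apply/funext => i; rewrite /phi /rmod [RHS]ractB.
apply: le_lt_trans (CP _) _; apply: le_lt_trans fe.
by rewrite mulrC ler_wpM2l ?lerDl // (fnorm_ge0 ipn_form).
Qed.

(** A limit u of generator values is realised by d x = K x u. Each derivation identity says that
    some right-linear map vanishes on all generator values of derivations, so it persists at u. *)
Lemma closed_Der11_closed (u : 'I_n -> LE) :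
  (forall e : R[i], 0 < e -> exists2 v, V v & normn (v - u) < e) -> V u.
Proof.
move=> uV.
(* Off A the choice is the zero map; values there carry no meaning. *)
have /choice[K KP] x : exists K, A x -> right_lin A K /\ forall d, Der B A d -> d x = K (phi X d).
  have [Ax|nAx] := pselect (A x); last by exists (fun=> 0).
  have [K [gK KP]] := derivation_eval hB hA (@subset_refl _ A) hX Ax.
  by exists K => _; split => // d /Der_rel; exact: KP.
have gK x : A x -> right_lin A (K x) by move=> /KP[].
have eK x d : A x -> Der B A d -> d x = K x (phi X d) by move=> /KP[_]; exact.
have van (G : ('I_n -> LE) -> LE) : right_lin A G -> (forall d, Der B A d -> G (phi X d) = 0) ->
    G u = 0.
  by move=> gG GD; apply: (right_lin_vanish gG _ uV) => _ [d [dD _] <-]; exact: GD.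
have uL i : LA (u i).
  apply: L2_sub_closed => e /uV[_ [d [[dA _] _] <-] h].
  exists (phi X d i); first by apply: (der_val dA); exact: (generating_mem hX).
  exact: le_lt_trans (normn_coord (phi X d - u) i) h.
pose d x := K x u.
have du : phi X d = u.
  apply/funext => i; have AX := generating_mem hX i.
  apply/eqP; rewrite -subr_eq0; apply/eqP.
  apply: (van (fun u => K (X i) u - u i)).
    by apply: right_lin_sub => //; [exact: gK|exact: right_lin_coord].
  by move=> f fD; rewrite -eK // subrr.
have dD : Der B A d.
  split; last first.
    move=> b Bb; have Ab := generating_sub hX Bb; apply: (van (K b)); first exact: gK.
    by move=> f fD; rewrite -eK //; case: fD => _; apply.
  split=> [x Ax|a x y Ax Ay|x y Ax Ay].
  - by apply: (right_lin_LA (gK _ Ax)) => i; exact: uL.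
  - apply/eqP; rewrite -subr_eq0; apply/eqP.
    have Axy := ussa_lin hA a Ax Ay.
    apply: (van (fun u => K (a *: x + y) u - (a *: K x u + K y u))).
      by apply: right_lin_sub => //; [exact: gK|apply: right_lin_DZ => //; exact: gK].
    move=> f fD; rewrite -!eK //; case: fD => -[_ fl _] _.
    by rewrite fl // subrr.
  - apply/eqP; rewrite -subr_eq0; apply/eqP.
    have Axy := ussa_mul hA Ax Ay.
    apply: (van (fun u => K (x \o y) u - (bimod x (K y u) id + bimod id (K x u) y))).
      apply: right_lin_sub => //; first exact: gK.
      by apply: right_lin_add => //; apply: right_lin_bimod => //; exact: gK.
    move=> f fD; rewrite -!eK //; case: fD => -[_ _ fm] _.
    by rewrite fm // subrr.
exists d => //; split => // e e0.
have e2 : 0 < e / 2 by rewrite divr_gt0.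
have [_ [f [fD fP] <-] fu] := uV _ e2.
have [g gD gf] := fP _ e2.
exists g => //.
have -> : phi X (d - g) = phi X (d - f) + phi X (f - g).
  by apply/funext => i; rewrite /phi; exact: (esym (subrKA _ _ _)).
apply: le_lt_trans (fnormD ipn_form _ _) _; rewrite [e]splitr ltrD //.
have -> : phi X (d - f) = u - phi X f by rewrite -du.
by rewrite (fnormB ipn_form).
Qed.

Lemma closed_Der11_submodule : right_submodule A V.
Proof.
split.
- split.
  + exists 0 => //; split; first exact: Der_zero.
    move=> e e0; exists 0; first exact: Der11_zero.
    rewrite subrr (_ : phi X 0 = 0) //.
    by have := fnorm0 (@ipn_form R LE n); rewrite /fnorm /normn => ->.
  + move=> a _ _ [d dP <-] [d' dP' <-]; exists (a *: d + d') => //.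
    exact: closed_Der11_DZ.
  + exact: closed_Der11_closed.
- move=> _ i [d [[dA _] _] <-]; apply: (der_val dA); exact: (generating_mem hX).
- move=> p q _ Ap Aq [d dP <-]; exists (der_ract d p q) => //.
  exact: closed_Der11_ract.
Qed.

End Evaluation.
End Vanishing.

End Derivations.

(** * Separability of finite-dimensional subalgebras *)

Section Casimir.
Context {R : realType} {M : tracialVN R} (LM : gns M).
Variable B : set (M -> M).
Hypotheses (hB : unital_star_subalgebra B) (hBM : B `<=` vN_alg M).
Let hQM := vN_ussa M.
Let hL := hilbert_form LM.
Implicit Types (x y b : M -> M).

Let beta x y := ip (hat LM x) (hat LM y).

Lemma hat_inj0 x : vN_alg M x -> hat LM x = 0 -> x = 0.
Proof.
move=> Qx x0; have Qx' := ussa_starE hQM Qx.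
apply: (fnts_faithful (vN_trP M) Qx Qx' (star_adj hQM Qx)).
by rewrite -(ip_hat LM) // x0 (form0l hL).
Qed.

Lemma hat_sum n (c : 'I_n -> R[i]) (e : 'I_n -> M -> M) :
  (forall i, B (e i)) -> hat LM (\sum_i c i *: e i) = \sum_i c i *: hat LM (e i).
Proof.
move=> Be.
suff [] : B (\sum_i c i *: e i) /\
  hat LM (\sum_i c i *: e i) = \sum_i c i *: hat LM (e i) by [].
apply: (big_ind2 (fun (a : M -> M) (b : LM) => B a /\ hat LM a = b)) => [|x u y v [Bx <-] [By <-]|i _].
- split; first exact: ussa0.
  have B0 := hBM (ussa0 hB).
  by have := hatDZ LM (-1) B0 B0; rewrite scaler0 addr0 scaleN1r addNr.
- by split; [exact: ussa_add|rewrite hatD //; exact: hBM].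
- split; first exact: ussa_scale.
  have B0 := hBM (ussa0 hB).
  have := hatDZ LM (-1) B0 B0; rewrite scaler0 addr0 scaleN1r addNr => h0.
  by have := hatDZ LM (c i) (hBM (Be i)) B0; rewrite h0 !addr0.
Qed.

Lemma ip_sumZl n (c : 'I_n -> R[i]) (u : 'I_n -> LM) v :
  ip (\sum_i c i *: u i) v = \sum_i c i * ip (u i) v.
Proof.
apply: (big_ind2 (fun (a : LM) (b : R[i]) => ip a v = b)) => [|x1 y1 x2 y2 <- <-|i _].
- exact: form0l hL _.
- exact: formDl hL _ _ _.
- exact: formZl hL _ _ _.
Qed.

Lemma ussa_sumZ n (c : 'I_n -> R[i]) (e : 'I_n -> M -> M) :
  (forall i, B (e i)) -> B (\sum_i c i *: e i).
Proof. by move=> Be; apply: (ussa_sum hB) => i; exact: ussa_scale. Qed.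

(** Gram-Schmidt for the trace inner product, carried out on the operators themselves. Dependent
    vectors are dropped, so N can be smaller than n. *)
Lemma orthonormal_family n (b : 'I_n -> M -> M) : (forall i, B (b i)) ->
  exists N (e : 'I_N -> M -> M), [/\ forall i, B (e i),
    forall i j, beta (e i) (e j) = (i == j)%:R &
    forall i, b i = \sum_k beta (b i) (e k) *: e k].
Proof.
elim: n b => [|n IH] b Bb.
  by exists 0%N, (fun=> 0); split => -[].
have [|N [e [Be oe be]]] := IH (fun i => b (lift ord0 i)).
  by move=> i; exact: Bb.
pose r := b ord0 - \sum_k beta (b ord0) (e k) *: e k.
have Bs : B (\sum_k beta (b ord0) (e k) *: e k) by exact: ussa_sumZ.
have Br : B r by apply: (ussa_add hB) => //; exact: (ussaN hB).
have hr : hat LM r = hat LM (b ord0) - \sum_k beta (b ord0) (e k) *: hat LM (e k).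
  have := hatDZ LM (-1) (hBM Bs) (hBM (Bb ord0)).
  by rewrite !scaleN1r hat_sum // addrC [RHS]addrC.
have re k : beta r (e k) = 0.
  rewrite /beta hr (formBl hL) ip_sumZl (bigD1 k) //= big1.
    by rewrite -/(beta (e k) (e k)) oe eqxx mulr1 addr0 subrr.
  by move=> j jk; rewrite -/(beta (e j) (e k)) oe (negbTE jk) mulr0.
have er k : beta (e k) r = 0 by rewrite /beta (form_conj hL) -/(beta r _) re rmorph0.
have [r0|r0] := eqVneq r 0.
  exists N, e; split => // i; case: (unliftP ord0 i) => [j|] ->; first exact: be.
  by apply/eqP; rewrite -subr_eq0 -/r r0.
pose s := `|hat LM r|.
(* Faithfulness of the trace: a nonzero operator has a nonzero class. *)
have s0 : s != 0 by rewrite normr_eq0; apply: contraNN r0 => /eqP/(hat_inj0 (hBM Br)) ->.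
have sC : s^* = s by apply: conj_Creal; rewrite normr_real.
pose t := s^-1 *: r.
have Bt : B t by exact: ussa_scale.
have ht : hat LM t = s^-1 *: hat LM r.
  by have := @hat_sum 1 (fun=> s^-1) (fun=> r) (fun=> Br); rewrite !big_ord1.
pose e' (i : 'I_N.+1) := if unlift ord0 i is Some j then e j else t.
have e'0 : e' ord0 = t by rewrite /e' unlift_none.
have e'l j : e' (lift ord0 j) = e j by rewrite /e' liftK.
have te k : beta t (e k) = 0 by rewrite /beta ht (formZl hL) -/(beta r _) re mulr0.
have et k : beta (e k) t = 0 by rewrite /beta (form_conj hL) -/(beta t _) te rmorph0.
exists N.+1, e'; split.
- by move=> i; rewrite /e'; case: unlift.
- move=> i j; case: (unliftP ord0 i) => [i'|] ->; case: (unliftP ord0 j) => [j'|] ->.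
  + by rewrite !e'l oe (inj_eq lift_inj).
  + by rewrite e'l e'0 et eq_sym (negbTE (neq_lift _ _)).
  + by rewrite e'l e'0 te (negbTE (neq_lift _ _)).
  + rewrite e'0 eqxx /beta ht (formZl hL) (formZr hL) fmorphV /= sC ip_norm -/s.
    by rewrite expr2; field.
- move=> i; rewrite big_ord_recl e'0; under eq_bigr do rewrite e'l.
  case: (unliftP ord0 i) => [j|] ->.
    rewrite -be; have -> : beta (b (lift ord0 j)) t = 0; last by rewrite scale0r add0r.
    rewrite [b _]be /beta hat_sum // ip_sumZl big1 // => k _.
    by rewrite -/(beta (e k) t) et mulr0.
  have bE : b ord0 = r + \sum_k beta (b ord0) (e k) *: e k by rewrite subrK.
  rewrite {1}bE; congr (_ + _).
  have -> : beta (b ord0) t = s.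
    rewrite {1}bE /beta hatD ?hat_sum //; try exact: hBM.
    rewrite (formDl hL) ip_sumZl big1.
      rewrite addr0 ht (formZr hL) fmorphV /= sC ip_norm -/s expr2.
      by rewrite mulKf.
    by move=> k _; rewrite -/(beta (e k) t) et mulr0.
  by rewrite /t scalerA divff // scale1r.
Qed.

Lemma comp_sumZr n (c : 'I_n -> R[i]) (e : 'I_n -> M -> M) x : B x ->
  x \o (\sum_i c i *: e i) = \sum_i c i *: (x \o e i).
Proof.
move=> Bx; rewrite (ussa_comp_sumr hB) //; apply: eq_bigr => i _.
apply/funext => v /=; have [xl _] := ussa_bounded hB Bx.
have x0 : x 0 = 0 by have := xl (-1) 0 0; rewrite scaler0 addr0 scaleN1r addNr.
by have := xl (c i) (e i v) 0; rewrite x0 !addr0.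
Qed.

Lemma comp_sumZl n (c : 'I_n -> R[i]) (e : 'I_n -> M -> M) x :
  (\sum_i c i *: e i) \o x = \sum_i c i *: (e i \o x).
Proof. by rewrite comp_suml; apply: eq_bigr. Qed.

Lemma star_sumZ n (c : 'I_n -> R[i]) (e : 'I_n -> M -> M) : (forall i, B (e i)) ->
  star (\sum_i c i *: e i) = \sum_i (c i)^* *: star (e i).
Proof.
move=> Be.
have star0 : star (0 : M -> M) = 0.
  by apply: star_eq => u v; rewrite (form0l (hilbert_form M)) (form0r (hilbert_form M)).
suff [] : B (\sum_i c i *: e i) /\
  star (\sum_i c i *: e i) = \sum_i (c i)^* *: star (e i) by [].
apply: (big_ind2 (fun a b : M -> M => B a /\ star a = b)) => [|x u y v [Bx <-] [By <-]|i _].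
- by split; first exact: ussa0.
- split; first exact: ussa_add.
  by have := starDZ hB 1 Bx By; rewrite rmorph1 !scale1r.
- split; first exact: ussa_scale.
  by have := starDZ hB (c i) (Be i) (ussa0 hB); rewrite star0 !addr0.
Qed.

(* With [e] orthonormal for the trace, [\sum_k e_k (x) e_k^*] commutes with [B];
   its product [Omega = \sum_k e_k e_k^*] is central and injective, so dividing
   by it gives a separability idempotent [\sum_k p_k (x) q_k]. *)
Lemma separability_idempotent : finite_dimensional B ->
  exists N (p q : 'I_N -> M -> M), [/\ forall k, B (p k), forall k, B (q k),
    \sum_k (p k \o q k) = id &
    forall b, B b -> exists c : 'I_N -> 'I_N -> R[i],
      (forall k, b \o p k = \sum_l c k l *: p l) /\
      (forall l, q l \o b = \sum_k c k l *: q k)].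
Proof.
move=> [n [b0 BE]].
have [|N [e [Be oe be]]] := @orthonormal_family n b0.
  move=> i; rewrite BE; exists (fun j => (j == i)%:R).
  rewrite (bigD1 i) //= eqxx scale1r big1 ?addr0 // => j /negbTE ->.
  by rewrite scale0r.
have parseval x : B x -> x = \sum_k beta x (e k) *: e k.
  rewrite BE => -[c ->].
  have Bb i : B (b0 i) by rewrite be; exact: ussa_sumZ.
  transitivity (\sum_i c i *: \sum_k beta (b0 i) (e k) *: e k).
    by apply: eq_bigr => i _; rewrite -be.
  under eq_bigr do rewrite scaler_sumr; rewrite exchange_big.
  apply: eq_bigr => k _; rewrite /beta hat_sum // ip_sumZl scaler_suml.
  by apply: eq_bigr => i _; rewrite scalerA.
have Bse k : B (star (e k)) by exact: ussa_starE.
(* The same coefficients describe b acting on the left of the e_k and on the right of the e_l^*,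
   because <b e_k, e_l> = <e_k, b^* e_l>. *)
have castar b k : B b -> b \o e k = \sum_l beta (b \o e k) (e l) *: e l.
  by move=> Bb; apply: parseval; exact: ussa_mul.
have castarl b l : B b -> star (e l) \o b = \sum_k beta (b \o e k) (e l) *: star (e k).
  move=> Bb; have Bb' := ussa_starE hB Bb.
  rewrite -{1}(starK hB Bb) -(starM hB) // (parseval _ (ussa_mul hB Bb' (Be l))).
  rewrite star_sumZ //; apply: eq_bigr => k _; congr (_ *: _).
  have [Qb Qb' Qe] := And3 (hBM Bb) (hBM Bb') (fun i => hBM (Be i)).
  by rewrite /beta -(form_conj hL) -(lmul_hat LM Qb') // -lmul_star // lmul_hat.
pose Om := \sum_k (e k \o star (e k)).
have BOm : B Om by apply: (ussa_sum hB) => i; apply: (ussa_mul hB).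
have Omc b : B b -> b \o Om = Om \o b.
  move=> Bb; rewrite (ussa_comp_sumr hB _ Bb) comp_suml.
  transitivity (\sum_k \sum_l beta (b \o e k) (e l) *: (e l \o star (e k))).
    apply: eq_bigr => k _; rewrite -comp_sumZl -castar //.
  rewrite exchange_big; apply: eq_bigr => l _.
  rewrite -comp_sumZr // -castarl //.
(* <Om x, x> is the sum of the ||e_k^* x||^2, so every e_k^* x vanishes; and 1 = 1^* is a
   combination of the e_k^*. *)
have Om_inj x : B x -> Om \o x = 0 -> x = 0.
  move=> Bx Ox0.
  have ex k : B (star (e k) \o x) by exact: ussa_mul.
  have h : \sum_k beta (star (e k) \o x) (star (e k) \o x) = 0.
    transitivity (beta (Om \o x) x); last first.
      rewrite Ox0 /beta; have := @hat_sum 0 (fun=> 0) (fun=> 0).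
      by rewrite !big_ord0 => -> //; [rewrite (form0l hL)|case].
    have -> : Om \o x = \sum_k (1 : R[i]) *: (e k \o (star (e k) \o x)).
      by rewrite comp_suml; apply: eq_bigr => k _; rewrite scale1r.
    rewrite /beta hat_sum; last by move=> k; exact: ussa_mul.
    rewrite ip_sumZl; apply: eq_bigr => k _; rewrite mul1r.
    rewrite -[in RHS](lmul_hat LM (hBM (Be k)) (hBM (ex k))) lmul_star; last exact: hBM.
    by rewrite lmul_hat //; exact: hBM.
  have h0 k : star (e k) \o x = 0.
    apply: hat_inj0; first exact: hBM.
    apply: (form_def hL); move/eqP: h; rewrite psumr_eq0 => [|i _]; last exact: form_ge0 hL _.
    by move=> /allP/(_ k); rewrite mem_index_enum => /(_ isT)/eqP.
  have star1 : star (id : M -> M) = id by exact: star_eq.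
  have -> : x = star id \o x by rewrite star1.
  rewrite (parseval id (ussa_id hB)) star_sumZ // comp_sumZl big1 // => k _.
  by rewrite h0 scaler0.
(* The matrix of left multiplication by [Om] on coordinates, as row vectors; injectivity makes it
   invertible. *)
pose G : 'M[R[i]]_N := \matrix_(k, l) beta (Om \o e k) (e l).
pose vec (v : 'rV[R[i]]_N) := \sum_k v 0 k *: e k.
have Bvec v : B (vec v) by exact: ussa_sumZ.
have vecE v l : beta (vec v) (e l) = v 0 l.
  rewrite /beta hat_sum // ip_sumZl (bigD1 l) //= big1 ?addr0.
    by rewrite -/(beta (e l) (e l)) oe eqxx mulr1.
  by move=> k kl; rewrite -/(beta (e k) (e l)) oe (negbTE kl) mulr0.
have Omv v : Om \o vec v = vec (v *m G).
  rewrite comp_sumZr // [LHS]parseval; last first.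
    by apply: ussa_sumZ => k; exact: ussa_mul.
  apply: eq_bigr => l _; congr (_ *: _); rewrite mxE /beta hat_sum.
    by rewrite ip_sumZl; apply: eq_bigr => k _; rewrite mxE.
  by move=> k; exact: ussa_mul.
have Gu : G \in unitmx.
  rewrite -row_free_unit -kermx_eq0; apply/eqP/row_matrixP => i; rewrite row0.
  set v := row i _; have vG : v *m G = 0.
    by rewrite -row_mul mulmx_ker row0.
  have := Om_inj _ (Bvec v); rewrite Omv vG.
  have -> : vec 0 = 0 by rewrite /vec big1 // => k _; rewrite mxE scale0r.
  move=> /(_ erefl) v0; apply/rowP => l; rewrite -vecE v0 mxE.
  rewrite /beta; have := @hat_sum 0 (fun=> 0) (fun=> 0).
  by rewrite !big_ord0 => -> //; [rewrite (form0l hL)|case].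
(* The inverse of [Om] inside B: the coordinates of 1 times the inverse matrix. *)
pose c := vec ((\row_k beta id (e k)) *m invmx G).
have Bc : B c by exact: Bvec.
have Omc1 : Om \o c = id.
  rewrite Omv mulmxKV // [RHS](parseval _ (ussa_id hB)).
  by apply: eq_bigr => k _; rewrite mxE.
have cOm : c \o Om = id by rewrite Omc.
have cc b : B b -> b \o c = c \o b.
  move=> Bb; transitivity ((c \o Om) \o (b \o c)); first by rewrite cOm.
  transitivity (c \o (Om \o b) \o c); first by [].
  rewrite -(Omc b Bb); transitivity ((c \o b) \o (Om \o c)); first by [].
  by rewrite Omc1.
exists N, (fun k => c \o e k), (fun k => star (e k)); split => //.
- by move=> k; exact: ussa_mul.
- rewrite -[RHS]cOm (ussa_comp_sumr hB) //.
- move=> b Bb; exists (fun k l => beta (b \o e k) (e l)); split=> [k|l]; last exact: castarl.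
  transitivity ((b \o c) \o e k); first by [].
  rewrite cc //; transitivity (c \o (b \o e k)); first by [].
  by rewrite {1}castar // comp_sumZr.
Qed.

End Casimir.

(** * Additivity of the free Stein dimension *)

Section SteinDimension.
Context {R : realType} {M : tracialVN R} {Mo : opposite M}
  {E : vN_tensor M Mo} (LM : gns M) (LE : gns E).
Let hQM := vN_ussa M.
Let hL := hilbert_form LE.
Let Q1 : vN_alg M id := ussa_id hQM.
Notation one := (one_tensor_one LE).
Notation L2A A := (L2_sub LE (alg_tensor_opp (E := E) A)).
Notation inner := (@inner R M Mo E LE).

Lemma scalars_ussa : unital_star_subalgebra (scalars : set (M -> M)).
Proof.
have sc a : vN_alg M (a *: (id : M -> M)) by exact: (ussa_scale hQM).
split.
- by move=> _ [a ->]; exact: (ussa_bounded hQM (sc a)).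
- by exists 1; rewrite scale1r.
- by move=> _ _ [a ->] [b ->]; exists (a + b); rewrite scalerDl.
- by move=> a _ [b ->]; exists (a * b); rewrite scalerA.
- by move=> _ _ [a ->] [b ->]; exists (a * b); rewrite -scalerA.
- move=> _ [a ->]; exists (a^* *: id); first by exists a^*.
  move=> u v.
  by rewrite [LHS](formZl (hilbert_form M)) [RHS](formZr (hilbert_form M)) conjCK.
Qed.

Lemma scalars_sub (B : set (M -> M)) : unital_star_subalgebra B -> scalars `<=` B.
Proof. by move=> hB _ [a ->]; exact: (ussa_scale hB _ (ussa_id hB)). Qed.

Lemma inner_scalar xi b : scalars b -> inner xi b = 0.
Proof.
move=> [a ->]; have Q0 := ussa0 hQM.
have := bimodDZl a xi Q1 Q0 Q1; have := bimodDZr a xi Q1 Q1 Q0.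
have := bimodDZl (-1) xi Q0 Q0 Q1; have := bimodDZr (-1) xi Q1 Q0 Q0.
rewrite !scaler0 !addr0 !scaleN1r !addNr => -> -> h1 h2.
by rewrite /inner h1 h2 subrr.
Qed.

Lemma innerDZ (c : R[i]) xi eta x : vN_alg M x ->
  inner (c *: xi + eta) x = c *: inner xi x + inner eta x.
Proof.
by move=> Qx; rewrite /inner !bimodDZ // scalerBr opprD addrACA.
Qed.

Lemma inner_rel_derivation (A : set (M -> M)) xi : A `<=` vN_alg M ->
  rel_derivation scalars A (inner xi).
Proof.
move=> hAM; split=> [a x y Ax Ay|x y Ax Ay|b]; last exact: inner_scalar.
- have [Qx Qy] := (hAM _ Ax, hAM _ Ay).
  by rewrite /inner bimodDZl // bimodDZr // scalerBr opprD addrACA.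
- have [Qx Qy] := (hAM _ Ax, hAM _ Ay).
  by rewrite /inner !bimodB // !bimodM // [RHS]addrA subrK.
Qed.

Lemma right_lin_inner (A : set (M -> M)) n (K : ('I_n -> LE) -> LE) x :
  unital_star_subalgebra A -> A `<=` vN_alg M -> A x -> right_lin A K ->
  right_lin A (fun u => inner (K u) x).
Proof.
move=> hA hAM Ax gK; apply: right_lin_sub => //; apply: right_lin_bimod => //; exact: ussa_id.
Qed.

Lemma Der11_closed (A B : set (M -> M)) n (X : 'I_n -> M -> M)
    (d : (M -> M) -> LE) :
  Der11 LM B A d -> closed_Der11 LM B A X d.
Proof.
move=> dD; split; first by case: dD.
move=> e e0; exists d => //; rewrite subrr (_ : phi X 0 = 0) //.
by have := fnorm0 (@ipn_form R LE n); rewrite /fnorm /normn => ->.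
Qed.

Lemma inner_Der11 (A : set (M -> M)) xi : unital_star_subalgebra A ->
  A `<=` vN_alg M -> L2A A xi -> Der11 LM scalars A (inner xi).
Proof.
move=> hA hAM Lxi; split; last exact: inner_in_dom.
by split; [exact: inner_derivation|exact: inner_scalar].
Qed.

(** * Inner parts of derivations from a separability idempotent *)

Section Splitting.
Variable B : set (M -> M).
Hypotheses (hB : unital_star_subalgebra B) (hBM : B `<=` vN_alg M).
Variables (N : nat) (p q : 'I_N -> M -> M).
Hypotheses (Bp : forall k, B (p k)) (Bq : forall k, B (q k)).
Hypothesis pq1 : \sum_k (p k \o q k) = id.
Hypothesis pqB : forall b, B b -> exists c : 'I_N -> 'I_N -> R[i],
  (forall k, b \o p k = \sum_l c k l *: p l) /\
  (forall l, q l \o b = \sum_k c k l *: q k).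

Definition splitting_vector (d : (M -> M) -> LE) : LE :=
  \sum_k bimod (p k) (d (q k)) id.

Let Qp k : vN_alg M (p k). Proof. exact/hBM/Bp. Qed.
Let Qq k : vN_alg M (q k). Proof. exact/hBM/Bq. Qed.

Lemma bimod_sumZl n (c : 'I_n -> R[i]) (x : 'I_n -> M -> M) (xi : LE) :
  (forall i, vN_alg M (x i)) ->
  bimod (\sum_i c i *: x i) xi id = \sum_i c i *: bimod (x i) xi id.
Proof.
move=> Qx; have Q0 := ussa0 hQM.
have b0 : bimod 0 xi id = 0.
  by have := bimodDZl (-1) xi Q0 Q0 Q1; rewrite scaler0 addr0 scaleN1r addNr.
suff [] : vN_alg M (\sum_i c i *: x i) /\
  bimod (\sum_i c i *: x i) xi id = \sum_i c i *: bimod (x i) xi id by [].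
apply: (big_ind2 (fun (a : M -> M) (b : LE) => vN_alg M a /\ bimod a xi id = b)).
- by split.
- move=> a u b v [Qa <-] [Qb <-]; split; first exact: (ussa_add hQM).
  by have := bimodDZl 1 xi Qa Qb Q1; rewrite !scale1r.
- move=> i _; split; first exact: (ussa_scale hQM).
  by have := bimodDZl (c i) xi (Qx i) Q0 Q1; rewrite b0 !addr0.
Qed.

Lemma rel_derivation_sum C (d : (M -> M) -> LE) n (c : 'I_n -> R[i]) (x : 'I_n -> M -> M) :
  rel_derivation C B d -> (forall i, B (x i)) ->
  d (\sum_i c i *: x i) = \sum_i c i *: d (x i).
Proof.
move=> dD Bx; have d0 := rel_derivation0 hB dD; case: dD => dl _ _.
suff [] : B (\sum_i c i *: x i) /\
  d (\sum_i c i *: x i) = \sum_i c i *: d (x i) by [].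
apply: (big_ind2 (fun (a : M -> M) (b : LE) => B a /\ d a = b)).
- by split; first exact: ussa0.
- move=> a u b v [Ba <-] [Bb <-]; split; first exact: (ussa_add hB).
  by have := dl 1 _ _ Ba Bb; rewrite !scale1r.
- move=> i _; split; first exact: (ussa_scale hB).
  by have := dl (c i) _ _ (Bx i) (ussa0 hB); rewrite d0 !addr0.
Qed.

(** Passing b through the idempotent turns b xi into the sum of the p_l d(q_l b). By Leibniz this is
    (sum of p_l q_l) d(b) + xi b, and the sum in brackets is 1. *)
Lemma derivation_splits C (d : (M -> M) -> LE) b : rel_derivation C B d -> B b ->
  d b = inner (splitting_vector d) b.
Proof.
move=> dD Bb; have [c [cp cq]] := pqB Bb; have Qb := hBM Bb.
have dm := let: And3 _ h _ := dD in h.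
rewrite /inner /splitting_vector !bimod_sum //.
have -> : \sum_k bimod b (bimod (p k) (d (q k)) id) id =
    \sum_l bimod (p l) (d (q l \o b)) id.
  transitivity (\sum_k \sum_l c k l *: bimod (p l) (d (q k)) id).
    apply: eq_bigr => k _; rewrite bimodM //.
    have -> : id \o id = id :> (M -> M) by [].
    by rewrite cp bimod_sumZl.
  rewrite exchange_big; apply: eq_bigr => l _.
  rewrite cq (rel_derivation_sum _ dD) // bimod_sum //.
  by apply: eq_bigr => k _; rewrite bimodZ.
have -> : \sum_l bimod (p l) (d (q l \o b)) id =
    d b + \sum_l bimod id (bimod (p l) (d (q l)) id) b.
  have db : d b = bimod (\sum_k (1 : R[i]) *: (p k \o q k)) (d b) id.
    by under eq_bigr do rewrite scale1r; rewrite pq1 bimod_id.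
  rewrite {1}db bimod_sumZl; last by move=> k; exact: (ussa_mul hQM).
  rewrite -big_split; apply: eq_bigr => l _ /=.
  by rewrite scale1r dm // bimodD // !bimodM.
by rewrite addrK.
Qed.

Lemma splitting_vector_L2 (A : set (M -> M)) (d : (M -> M) -> LE) :
  unital_star_subalgebra A -> A `<=` vN_alg M -> B `<=` A ->
  (forall k, L2A A (d (q k))) -> L2A A (splitting_vector d).
Proof.
move=> hA hAM BA dL; apply: L2_sub_sum => // k; apply: L2_sub_bimod => //.
- exact/BA/Bp.
- exact: ussa_id.
Qed.

Section Dimensions.
Variable A : set (M -> M).
Hypotheses (hA : unital_star_subalgebra A) (hAM : A `<=` vN_alg M).
Hypothesis BA : B `<=` A.
Let A1 : A id := ussa_id hA.
Let Ap k : A (p k). Proof. exact/BA/Bp. Qed.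
Let Aq k : A (q k). Proof. exact/BA/Bq. Qed.

Lemma eval_family C A0 n (X : 'I_n -> M -> M) : unital_star_subalgebra C ->
  unital_star_subalgebra A0 -> A0 `<=` A -> generating_set C A0 X ->
  exists K : (M -> M) -> ('I_n -> LE) -> LE,
    (forall x, A0 x -> right_lin A (K x)) /\
    (forall x d, A0 x -> rel_derivation C A0 d -> d x = K x (phi X d)).
Proof.
move=> hC hA0 A0A hX.
have /choice[K KP] x : exists K : ('I_n -> LE) -> LE, A0 x ->
    right_lin A K /\ forall d, rel_derivation C A0 d -> d x = K (phi X d).
  have [Ax|nAx] := pselect (A0 x); last by exists (fun=> 0).
  have [K [gK KP]] := derivation_eval LE hA hAM hC hA0 A0A hX Ax.
  by exists K.
exists K; split=> [x /KP[]//|x d /KP[_]]; exact.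
Qed.

Lemma right_lin_splitting n (K : (M -> M) -> ('I_n -> LE) -> LE) :
  (forall k, right_lin A (K (q k))) ->
  right_lin A (fun u => \sum_k bimod (p k) (K (q k) u) id).
Proof. by move=> gK; apply: right_lin_sum => // k; apply: right_lin_bimod. Qed.

Lemma normn_family n m (T : 'I_m -> ('I_n -> LE) -> LE) : (forall j, right_lin A (T j)) ->
  exists2 C : R[i], 0 <= C & forall u, normn (T^~ u) <= C * normn u.
Proof.
move=> gT.
have /choice[C CP] j : exists C : R[i], 0 <= C /\ forall u, `|T j u| <= C * normn u.
  by have [C ? ?] := right_lin_normn (gT j); exists C.
exists (\sum_j C j) => [|u]; first by apply: sumr_ge0 => j _; have [] := CP j.
apply: le_trans (normn_sum _) _; rewrite mulr_suml; apply: ler_sum => j _.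
by have [_] := CP j; exact.
Qed.

(** An operation F on derivations is continuous as soon as bounded maps T describe it on generator
    values. *)
Lemma closed_Der11_map C1 C2 n m (X1 : 'I_n -> M -> M) (X2 : 'I_m -> M -> M)
    (T : 'I_m -> ('I_n -> LE) -> LE) (F : ((M -> M) -> LE) -> (M -> M) -> LE) d :
  (forall j, right_lin A (T j)) ->
  (forall f, Der C1 A f -> Der C2 A (F f)) ->
  (forall f, Der11 LM C1 A f -> Der11 LM C2 A (F f)) ->
  (forall f, Der C1 A f -> T^~ (phi X1 f) = phi X2 (F f)) ->
  closed_Der11 LM C1 A X1 d -> closed_Der11 LM C2 A X2 (F d).
Proof.
move=> gT FD F11 TF [dD dP]; split; first exact: FD.
move=> e e0; have [C C0 CP] := normn_family gT.
have c1 : 0 < C + 1 by rewrite ltr_wpDl.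
have [f fD] := dP _ (divr_gt0 e0 c1); rewrite ltr_pdivlMr // => fe.
exists (F f); first exact: F11.
have -> : phi X2 (F d - F f) = T^~ (phi X1 (d - f)).
  apply/funext => j; rewrite /= -[phi X1 (d - f)]/(phi X1 d - phi X1 f) (right_linB _ _ (gT j)).
  have := congr1 (@^~ j) (TF _ dD); have := congr1 (@^~ j) (TF _ (proj1 fD)) => /= -> ->.
  by [].
apply: le_lt_trans (CP _) _; apply: le_lt_trans fe.
by rewrite mulrC ler_wpM2l ?lerDl // (fnorm_ge0 ipn_form).
Qed.

Section Assembly.
Variables (n m k : nat) (X : 'I_n -> M -> M) (Y : 'I_m -> M -> M) (Z : 'I_k -> M -> M).
Hypotheses (hX : generating_set scalars A X) (hY : generating_set B A Y)
  (hZ : generating_set scalars B Z).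

(** By [derivation_splits], these are the generator values of all derivations from B to L^2(A (x)
    A^o). *)
Let W2 : set ('I_k -> LE) := [set phi Z (inner xi) | xi in L2A A].

Lemma inner_image_submodule : right_submodule A W2.
Proof.
have [KZ [gKZ eKZ]] := eval_family scalars_ussa hB BA hZ.
have ZB j : B (Z j) := generating_mem hZ j.
split.
- split.
  + exists 0; first exact: L2_sub0.
    apply/funext => j; rewrite /phi /inner !bimod0 ?subrr //; exact: hBM.
  + move=> a _ _ [xi Lxi <-] [eta Leta <-]; exists (a *: xi + eta); first exact: L2_subDZ.
    by apply/funext => j; rewrite /phi innerDZ //; exact: hBM.
  + move=> u uW.
    (* The implementing vector is not unique; the splitting vector is a bounded right-linear choice
       of it. Hence u = [Z, Xi u], valid on W2, passes to limits. *)
    pose Xi w := \sum_l bimod (p l) (KZ (q l) w) id.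
    have gXi : right_lin A Xi by apply: right_lin_splitting => l; exact: gKZ.
    have Lu i : L2A A (u i).
      apply: L2_sub_closed => e /uW[_ [xi Lxi <-] h].
      exists (phi Z (inner xi) i); last exact: le_lt_trans (normn_coord (_ - u) i) h.
      by apply: (der_val (inner_derivation hA hAM Lxi)); exact: BA.
    exists (Xi u); first exact: (right_lin_LA gXi).
    apply/funext => j; apply/esym/eqP; rewrite -subr_eq0; apply/eqP.
    apply: (@right_lin_vanish _ _ _ _ _ A _ (fun u => u j - inner (Xi u) (Z j)) W2) => //.
      apply: right_lin_sub => //; first exact: right_lin_coord.
      by apply: right_lin_inner => //; exact: BA.
    move=> _ [xi Lxi <-]; apply/eqP; rewrite subr_eq0; apply/eqP.
    have dD := inner_rel_derivation xi hBM.
    rewrite [LHS](derivation_splits dD) //; congr (inner _ _).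
    by apply: eq_bigr => l _; rewrite -eKZ.
- move=> _ i [xi Lxi <-].
  by apply: (der_val (inner_derivation hA hAM Lxi)); exact: BA.
- move=> x y _ Ax Ay [xi Lxi <-].
  exists (ract (tensor_opp x y) xi); first exact: L2_sub_ract.
  apply/funext => j; rewrite /phi /rmod /inner.
  have t : vN_alg E (tensor_opp x y) by apply: tensor_opp_alg; exact: hAM.
  by rewrite [RHS]ractB // !bimod_ract //; exact: hBM.
Qed.

Lemma stein_dim_split :
  free_stein_dim LM LE scalars A X =
  free_stein_dim LM LE B A Y + vN_dim one W2.
Proof.
have [KX [gKX eKX]] := eval_family scalars_ussa hA (@subset_refl _ A) hX.
have [KY [gKY eKY]] := eval_family hB hA (@subset_refl _ A) hY.
have [KZ [gKZ eKZ]] := eval_family scalars_ussa hB BA hZ.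
have ZA j : A (Z j) by apply: BA; exact: (generating_mem hZ).
have XA i : A (X i) := generating_mem hX i.
have YA j : A (Y j) := generating_mem hY j.
have Der_B d : Der (LE := LE) scalars A d -> rel_derivation scalars B d.
  move=> [[_ dl dm] ds]; split => // *; [apply: dl|apply: dm]; exact: BA.
pose sv := splitting_vector.
pose XiX u := \sum_l bimod (p l) (KX (q l) u) id.
pose XiZ u := \sum_l bimod (p l) (KZ (q l) u) id.
have gXiX : right_lin A XiX by apply: right_lin_splitting => l; exact: gKX.
have gXiZ : right_lin A XiZ by apply: right_lin_splitting => l; exact: gKZ.
have XiXE d : Der scalars A d -> XiX (phi X d) = sv d.
  by move=> /Der_rel dD; apply: eq_bigr => l _; rewrite -eKX.
have XiZE d : rel_derivation scalars B d -> XiZ (phi Z d) = sv d.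
  by move=> dD; apply: eq_bigr => l _; rewrite -eKZ.
(* In generator coordinates: T1 removes the inner part, S1 includes the derivations vanishing on B,
   T2 restricts to B, and S2 extends a derivation of B to the inner derivation of A with the same
   splitting vector. *)
pose T1 j u := KX (Y j) u - inner (XiX u) (Y j).
pose S1 i u := KY (X i) u.
pose T2 j u := KX (Z j) u.
pose S2 i u := inner (XiZ u) (X i).
have gT1 j : right_lin A (T1 j).
  by apply: right_lin_sub => //; [exact: gKX|exact: right_lin_inner].
have gS1 i : right_lin A (S1 i) by exact: gKY.
have gT2 j : right_lin A (T2 j) by exact: gKX.
have gS2 i : right_lin A (S2 i) by exact: right_lin_inner.
have svL d : Der scalars A d -> L2A A (sv d).
  by move=> [dA _]; apply: splitting_vector_L2 => // l; apply: (der_val dA).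
pose F d := (-1) *: inner (sv d) + d.
have FE d x : F d x = d x - inner (sv d) x.
  by rewrite addrC -[in RHS]scaleN1r.
have F_Der d : Der scalars A d -> Der B A (F d).
  move=> dD; split.
    apply: derivation_DZ => //; last by case: dD.
    by apply: inner_derivation => //; exact: svL.
  by move=> b Bb; rewrite FE (derivation_splits (Der_B _ dD)) // subrr.
have F_Der11 d : Der11 LM scalars A d -> Der11 LM B A (F d).
  move=> [dD dd]; split; first exact: F_Der.
  have iA := inner_derivation hA hAM (svL _ dD).
  apply: in_dom_DZ => //; first by case: dD.
  by apply: inner_in_dom => //; exact: svL.
have T1E d : Der scalars A d -> T1^~ (phi X d) = phi Y (F d).
  move=> dD; apply/funext => j; rewrite /T1 /phi FE XiXE //.
  by rewrite -(eKX _ _ _ (Der_rel dD)).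
have B_scalars d : Der B A d -> Der (LE := LE) scalars A d.
  move=> [dA dB]; split => // b sb; apply: dB; exact: scalars_sub sb.
have S1E d : Der B A d -> S1^~ (phi Y d) = phi X d.
  by move=> dD; apply/funext => i; rewrite /S1 -(eKY _ _ _ (Der_rel dD)).
have T2E d : Der scalars A d -> T2^~ (phi X d) = phi Z d.
  by move=> dD; apply/funext => i; rewrite /T2 -(eKX _ _ _ (Der_rel dD)).
have S2E d : rel_derivation scalars B d -> S2^~ (phi Z d) = phi X (inner (sv d)).
  by move=> dD; apply/funext => i; rewrite /S2 XiZE.
(* Hence T1 S1 is the identity: nothing is subtracted from a derivation that vanishes on B. *)
have svB d : Der B A d -> sv d = 0.
  move=> [_ dB]; rewrite /sv /splitting_vector big1 // => l _.
  by rewrite dB // bimod0.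
have phiZ d : Der scalars A d -> phi Z d = phi Z (inner (sv d)).
  move=> dD; apply/funext => j; apply: (derivation_splits (Der_B _ dD)).
  exact: (generating_mem hZ).
rewrite /free_stein_dim.
apply: (vN_dim_split hA hAM (T1 := T1) (S1 := S1) (T2 := T2) (S2 := S2)) => //.
- exact: closed_Der11_submodule scalars_ussa hX.
- exact: closed_Der11_submodule hB hY.
- exact: inner_image_submodule.
- move=> _ [d dP <-]; exists (F d); last by rewrite -T1E //; case: dP.
  exact: (closed_Der11_map gT1 F_Der F_Der11 T1E).
- move=> _ [d dP <-]; exists d; last by rewrite S1E //; case: dP.
  apply: (closed_Der11_map (F := id) gS1 B_scalars _ S1E dP) => f [fD fd].
  by split => //; exact: B_scalars.
- move=> _ [d [dD _] <-]; exists (sv d); first exact: svL.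
  by rewrite T2E // -phiZ.
(* Inner derivations of A already lie in [Der11], so S2 reaches V without taking a limit. *)
- move=> _ [xi Lxi <-]; have iD := inner_rel_derivation xi hBM.
  rewrite S2E //; exists (inner (sv (inner xi))) => //.
  apply/Der11_closed/inner_Der11 => //.
  apply: splitting_vector_L2 => // l.
  by apply: (der_val (inner_derivation hA hAM Lxi)).
- move=> _ [d [dD _] <-]; rewrite S1E // T1E; last exact: B_scalars.
  apply/funext => j; rewrite /phi FE svB // /inner !bimod0 ?subrr ?subr0 //; exact: hAM.
(* The splitting vector of [., xi] may differ from xi, but both implement the same derivation on
   B. *)
- move=> _ [xi Lxi <-]; have iD := inner_rel_derivation xi hBM.
  have Lsv : L2A A (sv (inner xi)).
    apply: splitting_vector_L2 => // l.
    by apply: (der_val (inner_derivation hA hAM Lxi)).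
  have [iA _] := inner_Der11 hA hAM Lsv.
  rewrite S2E // T2E //; apply/funext => j.
  by rewrite /phi -(derivation_splits iD) //; exact: (generating_mem hZ).
- move=> _ i [d [dD _] <-].
  rewrite T1E // T2E // (congr1 (@^~ i) (S1E _ (F_Der _ dD))).
  by rewrite (congr1 (@^~ i) (S2E _ (Der_B _ dD))) /phi FE subrK.
Qed.

(* On the vectors [1 (x) 1] the projections onto the inner derivations with values
   in [L2A A] and in [L2A B] agree: for [u] with entries in [L2A B], the
   vector [\sum_j [Z_j^*, u_j]] lies in [L2A B], so it vanishes as soon as
   [u] is orthogonal to the inner derivations implemented by [L2A B]. *)
Lemma stein_dim_base : vN_dim one W2 = free_stein_dim LM LE scalars B Z.
Proof.
set W3 := [set phi Z d | d in closed_Der11 (LE := LE) LM scalars B Z].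
have hW3 : right_submodule B W3.
  exact: closed_Der11_submodule scalars_ussa hZ.
have ZB j : B (Z j) := generating_mem hZ j.
(* Over B itself every derivation is inner, hence in [Der11], and the closure adds nothing. *)
have W3E w : W3 w <-> exists2 xi, L2A B xi & phi Z (inner xi) = w.
  split=> [[d [dD _] <-]|[xi Lxi <-]].
    have dr := Der_rel dD.
    exists (splitting_vector d).
      by apply: splitting_vector_L2 => // l; apply: (der_val (proj1 dD)).
    by apply/funext => j; rewrite /phi -(derivation_splits dr).
  by exists (inner xi) => //; apply/Der11_closed/inner_Der11.
(* The two traces agree term by term: the projection of each test vector onto [W3] is also its
   projection onto the larger [W2]. *)
congr complex.Re; apply: eq_bigr => i _; congr (ip (_ i) _).
set e := fun j => _.
have [W3p W3o] := projP (rsub_closed hW3) e.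
apply: proj_uniq; first exact: (rsub_closed inner_image_submodule).
  have /W3E[xi Lxi <-] := W3p; exists xi => //.
  exact: L2_subS BA _ Lxi.
move=> _ [xi _ <-]; set u := e - _.
have Lu j : L2A B (u j).
  apply: L2_subB => //; last exact: (rsub_L2 hW3).
  by rewrite /e; case: ifP => _; [exact: L2_sub_one|exact: L2_sub0].
pose eta := \sum_j inner (u j) (star (Z j)).
have etaE x : ipn u (phi Z (inner x)) = ip eta x.
  rewrite /eta (big_morph (fun w => ip w x) (fun a b => formDl hL a b x) (form0l hL _)).
  apply: eq_bigr => j _; have Qz := hBM (ZB j); have Qz' := ussa_starE hQM Qz.
  have star1 : star (id : M -> M) = id by exact: star_eq.
  rewrite /phi /inner (formBr hL) [RHS](formBl hL) !bimod_adj //.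
  by rewrite (starK hQM) // star1.
have Leta : L2A B eta.
  apply: L2_sub_sum => // j.
  by apply: (der_val (inner_derivation hB hBM (Lu j))); exact: ussa_starE.
suff -> : ipn u (phi Z (inner xi)) = ip (0 : LE) xi by exact: (form0l hL).
rewrite etaE; congr ip; apply: (form_def hL).
by rewrite -etaE; apply: W3o; apply/W3E; exists eta.
Qed.

End Assembly.
End Dimensions.
End Splitting.
End SteinDimension.

Theorem theorem2p1 (R : realType)
  (M : tracialVN R) (Mo : opposite M) (E : vN_tensor M Mo)
  (LM : gns M) (LE : gns E)
  (A B : set (M -> M))
  (hA : unital_star_subalgebra A) (hAM : A `<=` vN_alg M)
  (hB : unital_star_subalgebra B) (hBA : B `<=` A)
  (hBfin : finite_dimensional B)
  (n : nat) (X : 'I_n -> M -> M) (hX : generating_set scalars A X)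
  (m : nat) (Y : 'I_m -> M -> M) (hY : generating_set B A Y)
  (k : nat) (Z : 'I_k -> M -> M) (hZ : generating_set scalars B Z) :
  free_stein_dim LM LE scalars A X =
  free_stein_dim LM LE B A Y + free_stein_dim LM LE scalars B Z.
Proof.
have hBM : B `<=` vN_alg M by move=> b /hBA/hAM.
have [N [p [q [Bp Bq pq1 pqB]]]] := separability_idempotent LM hB hBM hBfin.
rewrite -(stein_dim_base LM LE hB hBM Bp Bq pq1 pqB hA hAM hBA hZ).
exact: (stein_dim_split LM LE hB hBM Bp Bq pq1 pqB hA hAM hBA hX hY hZ).
Qed.
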